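(* Let $R(g)$ be a trinomial algebra. Every finely homogeneous locally nilpotent derivation of $R(g)$ is elementary.
   Context: Let $\mathbb{K}$ be an algebraically closed field of characteristic zero. A $\mathbb{K}$-linear map $\delta\colon R\to R$ on a $\mathbb{K}$-algebra $R$ is a derivation if $\delta(fh)=\delta(f)h+f\delta(h)$ for all $f,h\in R$; it is locally nilpotent if for every $f\in R$ there is $k\in\mathbb{Z}_{\geqslant 0}$ with $\delta^k(f)=0$. Trinomial algebras. Fix $n_0,n_1,n_2\in\mathbb{Z}_{>0}$, put $n=n_0+n_1+n_2$, and for each $i=0,1,2$ fix a tuple $l_i=(l_{i1},\ldots,l_{in_i})\in\mathbb{Z}_{>0}^{n_i}$. In the polynomial algebra $\mathbb{K}[T_{ij}]=\mathbb{K}[T_{ij}\mid i=0,1,2,\ j=1,\ldots,n_i]$ put $T_i^{l_i}=T_{i1}^{l_{i1}}\cdots T_{in_i}^{l_{in_i}}$ and $g=T_0^{l_0}+T_1^{l_1}+T_2^{l_2}$ (a trinomial). The polynomial $g$ is irreducible, and the domain $R(g)=\mathbb{K}[T_{ij}]/(g)$ is called a trinomial algebra. The same notation is used for elements of $\mathbb{K}[T_{ij}]$ and their images in $R(g)$. Fine grading. Let $L$ be the $2\times n$ integer matrix $L=\begin{pmatrix}-l_0&l_1&0\\-l_0&0&l_2\end{pmatrix}$, $L^*$ its transpose, $K=\mathbb{Z}^n/\operatorname{Im}L^*$, $Q\colon\mathbb{Z}^n\to K$ the projection, and $e_{ij}$ the standard basis vectors of $\mathbb{Z}^n$. Setting $\deg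 T_{ij}=Q(e_{ij})$ defines a $K$-grading on $\mathbb{K}[T_{ij}]$ for which $g$ is homogeneous, hence a $K$-grading $\deg$ on $R(g)$, called the fine grading; ''homogeneous'' for elements refers to it. A derivation of $R(g)$ is finely homogeneous if it maps homogeneous elements to homogeneous elements for this grading (then there is $w_0\in K$, its degree, with $\delta(R(g)_w)\subseteq R(g)_{w+w_0}$ for all $w\in K$). Derivations $\delta_{C,\beta}$. Let $C=(c_0,c_1,c_2)$ with $c_i\in\mathbb{Z}$, $1\leqslant c_i\leqslant n_i$, and let $\beta=(\beta_0,\beta_1,\beta_2)\in\mathbb{K}^3$, $\beta\neq0$, $\beta_0+\beta_1+\beta_2=0$. Then either all $\beta_i\ne0$ or exactly one $\beta_{i_0}$ is zero. (i) If $\beta_i\neq0$ for all $i$ and there is at most one $i_1$ with $l_{i_1c_{i_1}}>1$, set $\delta_{C,\beta}(T_{ic_i})=\beta_i\prod_{k\neq i}\frac{\partial T_k^{l_k}}{\partial T_{kc_k}}$ and $\delta_{C,\beta}(T_{ij})=0$ for $j\neq c_i$. (ii) If $\beta_{i_0}=0$ for a unique $i_0$ and there is at most one $i_1\neq i_0$ with $l_{i_1c_{i_1}}>1$, set $\delta_{C,\beta}(T_{ic_i})=\beta_i\prod_{k\neq i,i_0}\frac{\partial T_k^{l_k}}{\partial T_{kc_k}}$ and $\delta_{C,\beta}(T_{ij})=0$ for $j\neq c_i$ (so in particular $\delta_{C,\beta}(T_{i_0j})=0$ for all $j$). Extended by the Leibniz rule, these assignments annihilate $g$ and induce a derivation $\delta_{C,\beta}$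 of $R(g)$, which is finely homogeneous and locally nilpotent. A derivation of $R(g)$ is elementary if it has the form $h\,\delta_{C,\beta}$, where $\delta_{C,\beta}$ is one of the derivations of (i) or (ii) and $h$ is a homogeneous element of $\operatorname{Ker}\delta_{C,\beta}$.
   Formalization: The derivation is assumed nonzero unless some derivation of type (i) or (ii) exists, since otherwise (e.g. all exponents at least 2) the zero derivation is finely homogeneous and locally nilpotent but not elementary. *)

(* Defs.v *)
From HB Require Import structures.
From mathcomp Require Import all_boot all_order all_algebra.
From mathcomp Require Import boolp mpoly.

Set Implicit Arguments.
Unset Strict Implicit.
Unset Printing Implicit Defensive.

Import GRing.Theory.

Local Open Scope ring_scope.
Local Open Scope quotient_scope.

Section Derivations.
Variables (K : nzRingType) (A : algType K).

Definition is_derivation (delta : {linear A -> A}) : Prop :=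
  forall f h : A, delta (f * h) = delta f * h + f * delta h.

Definition locally_nilpotent (delta : A -> A) : Prop :=
  forall f : A, exists k : nat, iter k delta f = 0.

End Derivations.

(* The indices j = 1, ..., n_i are represented by 'I_(n_i), i.e. shifted to
   start from 0. *)
Record trinomial_data := TrinomialData {
  tri_n : 'I_3 -> nat;
  tri_n_gt0 : forall i, (0 < tri_n i)%N;
  tri_l : forall i, 'I_(tri_n i) -> nat;
  tri_l_gt0 : forall i (j : 'I_(tri_n i)), (0 < tri_l j)%N }.

Arguments tri_l : clear implicits.

Definition tri_dim (D : trinomial_data) : nat :=
  (\sum_(i < 3) tri_n D i)%N.

Section Trinomial.
Variables (K : fieldType) (D : trinomial_data).

Local Notation n := (tri_n D).
Local Notation l := (tri_l D).
Local Notation poly := {mpoly K[tri_dim D]}.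

(* tagnat.Rank is the bijection between the pairs (i, j) and the positions
   in the concatenation of three blocks of lengths n_0, n_1, n_2. *)
Definition tri_index (i : 'I_3) (j : 'I_(n i)) : 'I_(tri_dim D) :=
  tagnat.Rank i j.
Arguments tri_index : clear implicits.

Lemma eq_tri_index i i' (j : 'I_(n i)) (j' : 'I_(n i')) :
  (tri_index i j == tri_index i' j') = (i == i') && (j == j' :> nat).
Proof. exact: tagnat.eq_Rank. Qed.

Definition tri_var (i : 'I_3) (j : 'I_(n i)) : poly := 'X_(tri_index i j).
Arguments tri_var : clear implicits.

Definition tri_term (i : 'I_3) : poly := \prod_(j < n i) tri_var i j ^+ l i j.

Definition trinomial : poly := \sum_(i < 3) tri_term i.

Definition trinomial_ideal : {pred poly} :=
  fun p => `[< exists q : poly, p = q * trinomial >].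

Lemma trinomial_idealr_closed : idealr_closed trinomial_ideal.
Proof.
split.
- by apply/asboolP; exists 0; rewrite mul0r.
- apply/negP=> /asboolP[q /(congr1 (meval (fun=> 0)))].
  rewrite rmorph1 rmorphM /= /trinomial rmorph_sum /= [X in _ * X]big1 => [|i _].
    by rewrite mulr0; apply/eqP; rewrite oner_eq0.
  rewrite /tri_term rmorph_prod /= (bigD1 (Ordinal (tri_n_gt0 D i))) //=.
  by rewrite rmorphXn /= mevalXU expr0n gtn_eqF ?mul0r ?tri_l_gt0.
- move=> a u v /asboolP[p ->] /asboolP[q ->]; apply/asboolP.
  by exists (a * p + q); rewrite mulrDl mulrA.
Qed.

HB.instance Definition _ :=
  isIdealr.Build poly trinomial_ideal trinomial_idealr_closed.

Definition trinomial_algebra : Type := {ideal_quot trinomial_ideal}.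

HB.instance Definition _ := GRing.ComNzRing.on trinomial_algebra.

Local Notation R := trinomial_algebra.

Definition tri_proj : poly -> R := \pi_{ideal_quot trinomial_ideal}.

Lemma tri_proj_is_zmod_morphism : zmod_morphism tri_proj.
Proof. exact: (rmorphB \pi_{ideal_quot trinomial_ideal}). Qed.
HB.instance Definition _ :=
  GRing.isZmodMorphism.Build poly R tri_proj tri_proj_is_zmod_morphism.

Lemma tri_proj_is_monoid_morphism : monoid_morphism tri_proj.
Proof.
split; first exact: (rmorph1 \pi_{ideal_quot trinomial_ideal}).
exact: (rmorphM \pi_{ideal_quot trinomial_ideal}).
Qed.
HB.instance Definition _ :=
  GRing.isMonoidMorphism.Build poly R tri_proj tri_proj_is_monoid_morphism.

Definition tri_scale (a : K) (f : R) : R := tri_proj a%:MP * f.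

Lemma tri_scaleA a b f : tri_scale a (tri_scale b f) = tri_scale (a * b) f.
Proof. by rewrite /tri_scale mulrA -rmorphM -mpolyCM. Qed.
Lemma tri_scale1 : left_id 1 tri_scale.
Proof. by move=> f; rewrite /tri_scale mpolyC1 rmorph1 mul1r. Qed.
Lemma tri_scaleDr : right_distributive tri_scale +%R.
Proof. by move=> a f h; rewrite /tri_scale mulrDr. Qed.
Lemma tri_scaleDl f : {morph tri_scale^~ f : a b / a + b}.
Proof. by move=> a b; rewrite /tri_scale mpolyCD rmorphD mulrDl. Qed.

HB.instance Definition _ := GRing.Zmodule_isLmodule.Build K R
  tri_scaleA tri_scale1 tri_scaleDr tri_scaleDl.

Lemma tri_scaleAl (a : K) (f h : R) : a *: (f * h) = (a *: f) * h.
Proof. exact: mulrA. Qed.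

HB.instance Definition _ := GRing.Lmodule_isLalgebra.Build K R tri_scaleAl.
HB.instance Definition _ := GRing.Lalgebra_isComAlgebra.Build K R.

Lemma tri_proj_is_scalable : scalable tri_proj.
Proof. by move=> a p; rewrite -mul_mpolyC rmorphM. Qed.
HB.instance Definition _ :=
  GRing.isScalable.Build K poly R *:%R tri_proj tri_proj_is_scalable.

(* Rows 0, 1 are (-l_0, l_1, 0) and (-l_0, 0, l_2); \mxrow concatenates the
   blocks indexed by i in the same order as tri_index. *)
Definition tri_L : 'M[int]_(2, tri_dim D) :=
  \mxrow_(i < 3) \matrix_(r < 2, j < n i)
    (if i == 0 then - (l i j)%:Z
     else if i == r.+1 :> nat then (l i j)%:Z else 0).

Definition tri_imL : {pred 'cV[int]_(tri_dim D)} :=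
  fun u => `[< exists v : 'cV[int]_2, u = tri_L^T *m v >].

Lemma tri_imL_zmod_closed : zmod_closed tri_imL.
Proof.
split; first by apply/asboolP; exists 0; rewrite mulmx0.
move=> u v /asboolP[x ->] /asboolP[y ->]; apply/asboolP.
by exists (x - y); rewrite mulmxBr.
Qed.

HB.instance Definition _ :=
  GRing.isZmodClosed.Build 'cV[int]_(tri_dim D) tri_imL tri_imL_zmod_closed.

Definition grading_group : zmodType := Quotient.quot tri_imL.

Definition grading_proj (u : 'cV[int]_(tri_dim D)) : grading_group :=
  \pi_(Quotient.quot tri_imL) u.

Definition monomial_degree (m : 'X_{1..tri_dim D}) : grading_group :=
  \sum_(k < tri_dim D) grading_proj (delta_mx k 0) *+ m k.

(* f lies in the component R(g)_w; in particular 0 lies in every component. *)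
Definition homogeneous_of_degree (w : grading_group) (f : R) : Prop :=
  exists2 p : poly,
    forall m, m \in msupp p -> monomial_degree m = w & f = tri_proj p.

Definition homogeneous (f : R) : Prop := exists w, homogeneous_of_degree w f.

Definition finely_homogeneous (delta : R -> R) : Prop :=
  forall f : R, homogeneous f -> homogeneous (delta f).

Section DeltaCBeta.
Variables (c : forall i : 'I_3, 'I_(n i)) (beta : 'I_3 -> K).

Definition type_i : Prop :=
  (forall i, beta i != 0) /\
  (forall i1 i2, (1 < l i1 (c i1))%N -> (1 < l i2 (c i2))%N -> i1 = i2).

Definition type_ii : Prop :=
  exists i0 : 'I_3,
    [/\ beta i0 = 0, forall i, i != i0 -> beta i != 0
      & forall i1 i2, i1 != i0 -> i2 != i0 ->
          (1 < l i1 (c i1))%N -> (1 < l i2 (c i2))%N -> i1 = i2].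

Definition admissible : Prop :=
  [/\ exists i, beta i != 0, \sum_(i < 3) beta i = 0 & type_i \/ type_ii].

Definition dterm (k : 'I_3) : poly := (tri_term k)^`M(tri_index k (c k)).

(* The value at T_{i c_i}. The product runs over k != i in type (i), where all
   beta_k are nonzero, and over k != i, i0 in type (ii), where i0 is the only
   index with beta_{i0} = 0. *)
Definition delta_value (i : 'I_3) : poly :=
  beta i *: \prod_(k < 3 | (k != i) && (beta k != 0)) dterm k.

(* The K-derivation of the polynomial algebra with T_{i c_i} |-> delta_value i
   and T_{ij} |-> 0 for j != c_i. *)
Definition delta_poly (p : poly) : poly :=
  \sum_(i < 3) delta_value i * p^`M(tri_index i (c i)).

(* The induced map on the quotient; independence of the representative is
   delta_CB_proj below. *)
Definition delta_CB (f : R) : R := tri_proj (delta_poly (repr f)).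

Lemma delta_polyM (p q : poly) :
  delta_poly (p * q) = delta_poly p * q + p * delta_poly q.
Proof.
rewrite /delta_poly mulr_suml mulr_sumr; under eq_bigr => i _.
  rewrite mderivM mulrDr [X in X + _]mulrA [X in _ + X]mulrCA; over.
exact: big_split.
Qed.

Lemma delta_polyD (p q : poly) :
  delta_poly (p + q) = delta_poly p + delta_poly q.
Proof.
rewrite /delta_poly; under eq_bigr => i _ do rewrite mderivD mulrDr.
exact: big_split.
Qed.

Lemma delta_polyZ a (p : poly) : delta_poly (a *: p) = a *: delta_poly p.
Proof.
rewrite /delta_poly scaler_sumr; apply: eq_bigr => i _.
by rewrite mderivZ scalerAr.
Qed.

Lemma mderiv_tri_var i j k (m : 'I_(n k)) :
  (tri_var i j)^`M(tri_index k m)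
  = (tri_index i j == tri_index k m)%:R.
Proof.
rewrite /tri_var mderivX mnm1E; case: eqP => [->|_]; last by rewrite scale0r.
suff -> : (U_(tri_index k m) - U_(tri_index k m))%MM = 0%MM.
  by rewrite mpolyX0 scale1r.
by apply/mnmP=> s; rewrite mnmBE mnm0E subnn.
Qed.

Lemma delta_poly_var i j :
  delta_poly (tri_var i j) = if j == c i then delta_value i else 0.
Proof.
rewrite /delta_poly (bigD1 i) //= big1 => [|k /negPf ki].
  rewrite addr0 mderiv_tri_var eq_tri_index eqxx /=.
  by rewrite -val_eqE /=; case: ifP => _; rewrite ?mulr1 ?mulr0.
by rewrite mderiv_tri_var eq_tri_index eq_sym ki mulr0.
Qed.

Lemma delta_poly_term i : delta_poly (tri_term i) = delta_value i * dterm i.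
Proof.
rewrite /delta_poly (bigD1 i) //= big1 ?addr0 // => k /negPf ki.
suff -> : (tri_term i)^`M(tri_index k (c k)) = 0 by rewrite mulr0.
rewrite /tri_term; elim/big_ind: _ => [|p q p0 q0|j _]; first exact: mderivC.
  by rewrite mderivM p0 q0 mul0r mulr0 addr0.
elim: (l i j) => [|e IHe]; first exact: mderivC.
rewrite exprS mderivM IHe mulr0 addr0 mderiv_tri_var.
by rewrite eq_tri_index eq_sym ki mul0r.
Qed.

Lemma delta_poly_trinomial :
  \sum_(i < 3) beta i = 0 -> delta_poly trinomial = 0.
Proof.
move=> beta0; rewrite /trinomial (big_morph _ delta_polyD (id1 := 0)); last first.
  by rewrite /delta_poly big1 // => i _; rewrite mderiv0 mulr0.
under eq_bigr => i _ do rewrite delta_poly_term.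
have E i : delta_value i * dterm i =
    beta i *: \prod_(k < 3 | beta k != 0) dterm k.
  rewrite /delta_value; have [->|bi] := eqVneq (beta i) 0.
    by rewrite !scale0r mul0r.
  rewrite -scalerAl [in RHS](bigD1 i) //= [dterm i * _]mulrC.
  by under eq_bigl => k do rewrite andbC.
by under eq_bigr => i _ do rewrite E; rewrite -scaler_suml beta0 scale0r.
Qed.

Lemma delta_CB_proj p : \sum_(i < 3) beta i = 0 ->
  delta_CB (tri_proj p) = tri_proj (delta_poly p).
Proof.
move=> beta0; apply/eqP.
have /eqP : tri_proj (repr (tri_proj p)) = tri_proj p by exact: reprK.
rewrite -Quotient.idealrBE => /asboolP[q E]; rewrite -Quotient.idealrBE.
apply/asboolP; exists (delta_poly q).
have -> : delta_poly q * trinomial = delta_poly (q * trinomial).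
  by rewrite delta_polyM delta_poly_trinomial // mulr0 addr0.
by rewrite -E delta_polyD -[- p]scaleN1r delta_polyZ scaleN1r.
Qed.

End DeltaCBeta.

Definition elementary (delta : R -> R) : Prop :=
  exists (c : forall i : 'I_3, 'I_(n i)) (beta : 'I_3 -> K) (h : R),
    [/\ admissible c beta, homogeneous h, delta_CB c beta h = 0
      & forall f, delta f = h * delta_CB c beta f].

End Trinomial.

(* Main.v *)
(** Write x_i = T_i^{l_i}, so that x_0 + x_1 + x_2 = 0 in R(g). Since K is
    algebraically closed, every homogeneous element of R(g) is a product of a
    constant, variables T_ij and linear forms in x_0, x_1; each nonzero one is a
    regular element, and this is all that is needed of "R(g) is a domain".
    Let delta be a nonzero homogeneous locally nilpotent derivation. Its kernel
    is spanned by homogeneous elements and is closed under homogeneous factors,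
    and every derivation vanishing on it is proportional to delta. Applied to
    the derivations T_ij |-> c_ij T_ij with sum_j c_ij l_ij independent of i,
    this gives: in each block at most one variable T_{i c_i} lies outside the
    kernel, and some nonzero linear form a x_0 + b x_1 lies in the kernel. Hence
    delta(x_i) = beta_i q with beta = (b, -a, a - b). As delta(x_i) is also
    (d x_i / d T_{i c_i}) delta(T_{i c_i}), the element q is divisible by the
    pairwise coprime monomials d x_i / d T_{i c_i} with beta_i <> 0; the
    quotient of q by their product is the factor h. *)
Require Import Defs.
From HB Require Import structures.
From mathcomp Require Import all_boot all_order all_algebra.
From mathcomp Require Import boolp mpoly ring.

Set Implicit Arguments.
Unset Strict Implicit.
Unset Printing Implicit Defensive.

Import GRing.Theory.

Local Open Scope ring_scope.

(** * Locally nilpotent derivations: degree function, kernel, local slices *)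

Section LocallyNilpotent.
Variables (K : fieldType) (R : comAlgType K) (delta : {linear R -> R}).
Hypothesis charK0 : [pchar K] =i pred0.
Hypothesis delta_der : is_derivation delta.
Hypothesis delta_lnd : locally_nilpotent delta.

Lemma natr_lreg (n : nat) (x : R) : n.+1%:R * x = 0 -> x = 0.
Proof.
rewrite mulr_natl -scaler_nat => /eqP; rewrite scaler_eq0.
by rewrite (pcharf0P _).1 // => /eqP.
Qed.

Lemma derivation1 : delta 1 = 0.
Proof.
have := delta_der 1 1; rewrite !mulr1 mul1r => /eqP.
by rewrite -subr_eq0 opprD addNKr oppr_eq0 => /eqP.
Qed.

Lemma derivationX (f : R) n : delta (f ^+ n.+1) = (f ^+ n * delta f) *+ n.+1.
Proof.
elim: n => [|n IHn]; first by rewrite expr0 mul1r.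
rewrite exprS delta_der IHn mulrnAr mulrA -exprS [RHS]mulrS.
by rewrite [delta f * _]mulrC.
Qed.

Lemma iter_deltaD k f h :
  iter k delta (f + h) = iter k delta f + iter k delta h.
Proof. by elim: k => //= k ->; rewrite raddfD. Qed.

Lemma iter_delta0 k : iter k delta 0 = 0.
Proof. by elim: k => //= k ->; rewrite raddf0. Qed.

Lemma iter_deltaB k f h :
  iter k delta (f - h) = iter k delta f - iter k delta h.
Proof. by elim: k => //= k ->; rewrite raddfB. Qed.

Lemma iter_deltaMn k n f : iter k delta (f *+ n) = iter k delta f *+ n.
Proof. by elim: k => //= k ->; rewrite raddfMn. Qed.

Lemma iter_deltaMl k c f : delta c = 0 ->
  iter k delta (c * f) = c * iter k delta f.
Proof. by move=> c0; elim: k => //= k ->; rewrite delta_der c0 mul0r add0r. Qed.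

(** The degree function attached to a locally nilpotent derivation, encoded as a relation because 0
    has no degree. *)
Definition nil_degree (f : R) (a : nat) : Prop :=
  iter a delta f != 0 /\ iter a.+1 delta f = 0.

Lemma nil_degree_exists f : f != 0 -> exists a, nil_degree f a.
Proof.
move=> f0.
have ex : exists k, iter k delta f == 0.
  by have [k fk] := delta_lnd f; exists k; rewrite fk.
case: (ex_minnP ex) => -[|a] /eqP fa amin; first by rewrite -fa eqxx in f0.
by exists a; split=> //; apply/negP=> /amin; rewrite ltnn.
Qed.

Lemma iter_delta_le f a b : (a <= b)%N -> iter a delta f = 0 ->
  iter b delta f = 0.
Proof. by move=> /subnK <-; rewrite iterD => ->; rewrite iter_delta0. Qed.

Lemma nil_degree_uniq f a b : nil_degree f a -> nil_degree f b -> a = b.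
Proof.
move=> [fa fa1] [fb fb1]; apply/eqP; rewrite eqn_leq; apply/andP; split.
  by rewrite leqNgt; apply: contra fa => /iter_delta_le/(_ fb1) ->.
by rewrite leqNgt; apply: contra fb => /iter_delta_le/(_ fa1) ->.
Qed.

Lemma nil_degree_delta f a : nil_degree f a -> delta f != 0 ->
  exists2 b, a = b.+1 & nil_degree (delta f) b.
Proof.
case: a => [|b] [fa fb] f0;
  first by rewrite -[delta f]/(iter 1 delta f) fb eqxx in f0.
by exists b => //; split; rewrite -iterSr.
Qed.

(** In the Leibniz formula for the iterate of order a + b, only the term with a derivatives on f and
    b on h survives. The double induction rests on Pascal's rule. *)
Lemma iter_deltaM f h a b :
    iter a.+1 delta f = 0 -> iter b.+1 delta h = 0 ->
  iter (a + b) delta (f * h) =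
    (iter a delta f * iter b delta h) *+ 'C(a + b, a).
Proof.
elim: a b f h => [|a IHa] b f h.
  by move=> f0 _; rewrite add0n iter_deltaMl // bin0.
elim: b f h => [|b IHb] f h fa hb.
  rewrite addn0 binn mulr1n [f * h]mulrC iter_deltaMl // mulrC //.
rewrite addSn iterSr delta_der iter_deltaD IHa -?iterSr //.
rewrite addnS -addSn IHb -?iterSr //.
by rewrite -mulrnDr addnC [in RHS]addSn binS.
Qed.

(* H plays the role of homogeneity: regularity of the nonzero elements of H
   replaces the assumption that R is a domain. *)
Variable H : R -> Prop.
Hypothesis H_delta : forall f, H f -> H (delta f).
Hypothesis H_reg : forall f u, H f -> f != 0 -> f * u = 0 -> u = 0.
Hypothesis H_div : forall f u, H f -> f != 0 -> H (f * u) -> H u.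

Lemma H_iter f k : H f -> H (iter k delta f).
Proof. by move=> Hf; elim: k => //= k /H_delta. Qed.

Lemma H_mul_neq0 f h : H f -> f != 0 -> h != 0 -> f * h != 0.
Proof. by move=> Hf f0; apply: contra_neq => /(H_reg Hf f0). Qed.

(** The surviving Leibniz term is a binomial coefficient, invertible in characteristic zero, times a
    product of two nonzero iterates, nonzero since [iter a delta f] is regular. *)
Lemma nil_degreeM f h a b : H f -> H h ->
  nil_degree f a -> nil_degree h b -> nil_degree (f * h) (a + b).
Proof.
move=> Hf Hh [fa fa1] [hb hb1].
have E := iter_deltaM fa1 hb1.
split; last first.
  rewrite iterS E linearMn delta_der -!iterS fa1 hb1.
  by rewrite mul0r mulr0 addr0 mul0rn.
rewrite E; have : (0 < 'C(a + b, a))%N by rewrite bin_gt0 leq_addr.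
case: 'C(_, _) => // n _; rewrite -mulr_natl.
have := H_mul_neq0 (H_iter a Hf) fa hb.
by apply: contra_neq => /natr_lreg.
Qed.

(** Degrees add up, and a sum of naturals equal to 0 has both summands 0. *)
Lemma ker_factor_closed f h : H f -> H h -> f * h != 0 ->
  delta (f * h) = 0 -> delta f = 0.
Proof.
move=> Hf Hh fh0 dfh.
have f0 : f != 0 by apply: contra_neq fh0 => ->; rewrite mul0r.
have h0 : h != 0 by apply: contra_neq fh0 => ->; rewrite mulr0.
have [a da] := nil_degree_exists f0; have [b db] := nil_degree_exists h0.
have ab0 : (a + b = 0)%N by apply: (nil_degree_uniq (nil_degreeM Hf Hh da db)).
by case: a da ab0 => [|//] [].
Qed.

(** If both derivatives were nonzero, then deg f - 1 = deg h + deg u and deg h - 1 = deg f + deg v,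
    which is impossible for natural numbers. *)
Lemma dvd_delta_cross f h u v : H f -> H h ->
  delta f = h * u -> delta h = f * v -> delta f = 0 \/ delta h = 0.
Proof.
move=> Hf Hh df dh.
have [->|df0] := eqVneq (delta f) 0; first by left.
have [->|dh0] := eqVneq (delta h) 0; first by right.
have f0 : f != 0 by apply: contra_neq dh0 => f0; rewrite dh f0 mul0r.
have h0 : h != 0 by apply: contra_neq df0 => h0; rewrite df h0 mul0r.
have u0 : u != 0 by apply: contra_neq df0 => u0; rewrite df u0 mulr0.
have v0 : v != 0 by apply: contra_neq dh0 => v0; rewrite dh v0 mulr0.
have Hu : H u by apply: (H_div Hh h0); rewrite -df; apply: H_delta.
have Hv : H v by apply: (H_div Hf f0); rewrite -dh; apply: H_delta.
have [a da] := nil_degree_exists f0; have [b db] := nil_degree_exists h0.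
have [c dc] := nil_degree_exists u0; have [d dd] := nil_degree_exists v0.
have [a' aE da'] := nil_degree_delta da df0.
have [b' bE db'] := nil_degree_delta db dh0.
have a'E : a' = (b + c)%N.
  by apply: (nil_degree_uniq da'); rewrite df; apply: nil_degreeM.
have b'E : b' = (a + d)%N.
  by apply: (nil_degree_uniq db'); rewrite dh; apply: nil_degreeM.
exfalso; move: aE bE; rewrite a'E b'E => -> /eqP.
by rewrite -addSn -addnS addSnnS -addnA -[X in X == _]addn0 eqn_add2l.
Qed.

Lemma dvd_delta f u : H f -> delta f = f * u -> delta f = 0.
Proof. by move=> Hf df; case: (dvd_delta_cross Hf Hf df df). Qed.

(** The slice is the last but one nonzero iterate of f. *)
Lemma local_slice_exists f : H f -> delta f != 0 ->
  exists s, [/\ H s, delta s != 0 & delta (delta s) = 0].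
Proof.
move=> Hf /nil_degree_exists[a [fa fa1]]; exists (iter a delta f).
by split; [apply: H_iter | rewrite -iterS iterSr | rewrite -!iterS iterSr].
Qed.

Lemma iter_delta_slice s m : delta (delta s) = 0 ->
  iter m delta (s ^+ m) = delta s ^+ m *+ m`!.
Proof.
move=> ds; elim: m => [|m IHm]; first by rewrite fact0.
rewrite iterSr derivationX iter_deltaMn mulrC iter_deltaMl // IHm.
by rewrite mulrnAr -exprS -mulrnA mulnC -factS.
Qed.

(* Der(Frac R / Frac (ker delta)) is one-dimensional; the proof cancels the
   top term of f against a power of the slice s. *)
Lemma derivation_ker_prop (D : R -> R) s :
    (forall f h, D (f + h) = D f + D h) ->
    (forall f h, D (f * h) = D f * h + f * D h) ->
    (forall f, delta f = 0 -> D f = 0) ->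
    H s -> delta s != 0 -> delta (delta s) = 0 ->
  forall f, delta s * D f = D s * delta f.
Proof.
move=> DD DM Dker Hs ds0 dds f.
(* [E] is again a derivation; it vanishes on the kernel of [delta] and at [s]. It remains to kill it
   on every f, by induction on an order at which the iterates of f vanish. *)
pose E x := delta s * D x - D s * delta x.
suff: E f = 0 by move/eqP; rewrite subr_eq0 => /eqP.
have ED x y : E (x + y) = E x + E y.
  by rewrite /E DD raddfD !mulrDr opprD addrACA.
have EM x y : E (x * y) = E x * y + x * E y.
  by rewrite /E DM delta_der; ring.
have Eker x : delta x = 0 -> E x = 0.
  by move=> dx; rewrite /E Dker // dx !mulr0 subr0.
have Es : E s = 0 by rewrite /E mulrC subrr.
have EX m : E (s ^+ m) = 0.
  elim: m => [|m IHm]; first by apply/Eker/derivation1.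
  by rewrite exprS EM Es IHm mul0r mulr0 addr0.
have [k] := delta_lnd f.
elim: k f => [|m IHm] f fk.
  by rewrite [f](_ : _ = 0) //; apply: Eker; rewrite raddf0.
(* [c] is the m-th iterate of [s ^+ m] and lies in the kernel. Hence [c * f] and
   [iter m delta f * s ^+ m] have the same m-th iterate, and the induction hypothesis applies to
   their difference. *)
pose c := delta s ^+ m *+ m`!.
have dc : delta c = 0.
  rewrite linearMn; case: m {IHm fk} @c => [|m] c.
    by rewrite expr0 derivation1 mul0rn.
  by rewrite derivationX dds mulr0 !mul0rn.
have H1 : E (c * f - iter m delta f * s ^+ m) = 0.
  apply: IHm; rewrite iter_deltaB !iter_deltaMl //.
  by rewrite iter_delta_slice // mulrC subrr.
have H2 : E (c * f) = 0.
  rewrite -[c * f](subrK (iter m delta f * s ^+ m)) ED H1 EM EX.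
  by rewrite [E (iter m delta f)]Eker // mul0r mulr0 !addr0.
have H3 : c * E f = 0 by move: H2; rewrite EM [E c]Eker // mul0r add0r.
move: H3; rewrite /c -mulr_natl -mulrA.
have -> : m`! = (m`!.-1).+1 by rewrite prednK // fact_gt0.
move/natr_lreg; clear -Hs H_reg ds0 H_delta.
elim: m => [|m IHm]; first by rewrite expr0 mul1r.
by rewrite exprS -mulrA => /(H_reg (H_delta Hs) ds0)/IHm.
Qed.

End LocallyNilpotent.

(** * Linear maps prescribed on monomials, and coprime monomials *)

Section MonomialLinearExtension.
Variables (n : nat) (K : nzRingType) (V : lmodType K) (F : 'X_{1..n} -> V).

Definition mlin (p : {mpoly K[n]}) : V := \sum_(m <- msupp p) p@_m *: F m.

Lemma mlin_wE (s : seq 'X_{1..n}) p : uniq s -> {subset msupp p <= s} ->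
  mlin p = \sum_(m <- s) p@_m *: F m.
Proof.
move=> us sub; rewrite [RHS](bigID (mem (msupp p))) /= [X in _ + X]big1 => [|m].
  rewrite addr0 -big_filter; apply: perm_big; apply: uniq_perm => //.
    exact: filter_uniq.
  by move=> m; rewrite mem_filter; case: (boolP (m \in msupp p)) => // /sub.
by move/memN_msupp_eq0 ->; rewrite scale0r.
Qed.

Lemma mlin_is_linear : linear mlin.
Proof.
move=> a p q; pose s := undup (msupp p ++ msupp q ++ msupp (a *: p + q)).
rewrite !(@mlin_wE s) ?undup_uniq //.
2-4: by move=> m mp; rewrite mem_undup !mem_cat mp ?orbT.
rewrite scaler_sumr -big_split /=; apply: eq_bigr => m _.
by rewrite mcoeffD mcoeffZ scalerDl scalerA.
Qed.

HB.instance Definition _ :=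
  GRing.isLinear.Build K {mpoly K[n]} V *:%R mlin mlin_is_linear.

Lemma mlinX m : mlin 'X_[m] = F m.
Proof. by rewrite /mlin msuppX big_seq1 mcoeffX eqxx scale1r. Qed.

End MonomialLinearExtension.

Lemma mpoly_lin_ind n (K : nzRingType) (P : {mpoly K[n]} -> Prop) :
    P 0 -> (forall p q, P p -> P q -> P (p + q)) ->
    (forall a m, P (a *: 'X_[m])) -> forall p, P p.
Proof. by move=> P0 PD PX; elim/mpolyind => // c m p _ _; apply: PD. Qed.

Lemma mlin_mulX n (K : comNzRingType) (V : lmodType K)
    (F : 'X_{1..n} -> V) b p :
  mlin F ('X_[b] * p) = mlin (fun m => F (b + m)%MM) p.
Proof.
elim/mpoly_lin_ind: p => [|p q IHp IHq|a m]; first by rewrite mulr0 !linear0.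
  by rewrite mulrDr !linearD /= IHp IHq.
by rewrite -scalerAr -mpolyXD !linearZ /= !mlinX.
Qed.

Lemma mlin_mull n (K : comNzRingType) (A : comAlgType K)
    (F : 'X_{1..n} -> A) c p :
  mlin (fun m => c * F m) p = c * mlin F p.
Proof. by rewrite mulr_sumr; apply: eq_bigr => m _; rewrite scalerAr. Qed.

Lemma eq_mlin n (K : nzRingType) (V : lmodType K) (F G : 'X_{1..n} -> V) :
  F =1 G -> mlin F =1 mlin G.
Proof. by move=> E p; apply: eq_bigr => m _; rewrite E. Qed.

(** Every monomial of P times X^a is divisible by X^b; as a and b have disjoint supports, X^b
    already divides the monomial of P. *)
Lemma mpolyX_coprime_dvd N (K : idomainType) (a b : 'X_{1..N})
    (P Q : {mpoly K[N]}) :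
    (forall s, a s = 0%N \/ b s = 0%N) -> 'X_[a] * P = 'X_[b] * Q ->
  exists P', P = 'X_[b] * P'.
Proof.
move=> ab E; have bP m : m \in msupp P -> (b <= m)%MM.
  rewrite mcoeff_msupp -(mcoeffMX _ a) mulrC E mulrC -mcoeff_msupp.
  rewrite (perm_mem (msuppMX _ _)) => /mapP[m' _ E'].
  apply/mnm_lepP => s; have := congr1 (fun u : 'X_{1..N} => u s) E'.
  rewrite !mnmDE; case: (ab s) => -> //; rewrite add0n => ->; exact: leq_addr.
exists (\sum_(m <- msupp P) P@_m *: 'X_[m - b]).
rewrite mulr_sumr {1}[P]mpolyE big_seq [RHS]big_seq; apply: eq_bigr => m mP.
by rewrite -scalerAr -mpolyXD addmC submK // bP.
Qed.

(** * Normal forms modulo the trinomial and coprimality of the blocks *)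

Section TrinomialMonomials.
Variables (K : fieldType) (D : trinomial_data).
Local Notation n := (tri_n D).
Local Notation l := (tri_l D).
Local Notation poly := {mpoly K[tri_dim D]}.
Local Notation mon := ('X_{1..tri_dim D}).
Local Notation idx i j := (@tri_index D i j).
Local Notation x i := (@tri_term K D i).
Local Notation g := (@trinomial K D).
Local Notation pi := (@tri_proj K D).
Implicit Types (m b : mon) (i k : 'I_3).

Lemma tri_indexP (s : 'I_(tri_dim D)) : exists i j, s = idx i j.
Proof. by exists (tagnat.sig1 s), (tagnat.sig2 s);
  rewrite /tri_index tagnat.sig2K. Qed.

Lemma tri_mnmP m m' : (forall i j, m (idx i j) = m' (idx i j)) -> m = m'.
Proof. by move=> E; apply/mnmP => s; have [i [j ->]] := tri_indexP s. Qed.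

Lemma mnm1_idx i (j : 'I_(n i)) k (j' : 'I_(n k)) :
  U_(idx i j)%MM (idx k j') = ((i == k) && (j == j' :> nat)) :> nat.
Proof. by rewrite mnm1E eq_tri_index. Qed.

Definition tri_mon i : mon := (\sum_(j < n i) U_(idx i j) *+ l i j)%MM.

Lemma tri_monE i k j : tri_mon i (idx k j) = if i == k then l k j else 0%N.
Proof.
rewrite mnm_sumE; case: eqVneq => [E|ik]; last first.
  by rewrite big1 // => j' _; rewrite mulmnE mnm1_idx (negPf ik) mul0n.
case: _ / E j => j; rewrite (bigD1 j) //= big1 => [|j' jj'].
  by rewrite mulmnE mnm1_idx !eqxx mul1n addn0.
by rewrite mulmnE mnm1_idx eqxx val_eqE (negPf jj') mul0n.
Qed.

Lemma tri_termE i : x i = 'X_[tri_mon i].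
Proof. exact: mprodXnE. Qed.

(* The exponent of the largest power of T_i^{l_i} dividing the monomial m. *)
Definition block_floor i m : nat :=
  let j := [arg min_(j < Ordinal (tri_n_gt0 D i)) (m (idx i j) %/ l i j)%N] in
  (m (idx i j) %/ l i j)%N.

(** This adjunction characterizes [block_floor]; later arguments use it instead of the minimum. *)
Lemma block_floorP i m e :
  reflect (forall j, (e * l i j <= m (idx i j))%N) (e <= block_floor i m)%N.
Proof.
rewrite /block_floor /=; case: arg_minnP => // j _ jmin; apply: (iffP idP).
  by move=> ej j'; rewrite -leq_divRL ?tri_l_gt0 //;
    apply: leq_trans (jmin _ _).
by move/(_ j); rewrite leq_divRL ?tri_l_gt0.
Qed.

Lemma block_floor_uniq i m e :
  (forall e', reflect (forall j, (e' * l i j <= m (idx i j))%N) (e' <= e)%N) ->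
  block_floor i m = e.
Proof.
move=> eP; apply/eqP; rewrite eqn_leq; apply/andP; split.
  exact/eP/block_floorP.
exact/block_floorP/eP.
Qed.

Lemma block_floorD i m b : (forall j, b (idx i j) = 0%N) ->
  block_floor i (b + m)%MM = block_floor i m.
Proof.
move=> b0; apply: block_floor_uniq => e.
by apply: (iffP (block_floorP i m e)) => + j => /(_ j); rewrite mnmDE b0.
Qed.

Lemma block_floor_shift i m m' e :
    (forall j, m' (idx i j) = m (idx i j) + e * l i j)%N ->
  block_floor i m' = (block_floor i m + e)%N.
Proof.
move=> m'E; apply: block_floor_uniq => e'; rewrite addnC -leq_subLR.
apply: (iffP (block_floorP _ _ _)) => h j; have := h j;
  by rewrite m'E addnC mulnBl leq_subLR.
Qed.

Definition block_rem i m : mon := (m - tri_mon i *+ block_floor i m)%MM.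

Lemma block_floor_lep i m : (tri_mon i *+ block_floor i m <= m)%MM.
Proof.
apply/mnm_lepP => s; have [k [j ->]] := tri_indexP s.
rewrite mulmnE tri_monE; case: eqVneq => [E|_]; last by rewrite mul0n.
by case: _ / E j => j; rewrite mulnC; apply/block_floorP.
Qed.

Lemma block_remK i m : (tri_mon i *+ block_floor i m + block_rem i m)%MM = m.
Proof. by rewrite addmC submK // block_floor_lep. Qed.

(* The rewriting x_i -> - sum_{k <> i} x_k. As a map to polynomials without
   monomials divisible by x_i it identifies R(g) with a free module over the
   polynomials in the variables of the other two blocks. *)
Definition tri_reduce i : poly -> poly :=
  mlin (fun m => (- \sum_(k < 3 | k != i) x k) ^+ block_floor i m
                 * 'X_[block_rem i m]).
HB.instance Definition _ i := GRing.Linear.on (tri_reduce i).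

Lemma tri_reduceMX i b p : (forall j, b (idx i j) = 0%N) ->
  tri_reduce i ('X_[b] * p) = 'X_[b] * tri_reduce i p.
Proof.
move=> b0; rewrite /tri_reduce mlin_mulX -mlin_mull; apply: eq_mlin => m.
rewrite /block_rem block_floorD // mulrCA -mpolyXD addmBA //.
exact: block_floor_lep.
Qed.

Lemma tri_reduce_term i p :
  tri_reduce i (x i * p) = - (\sum_(k < 3 | k != i) x k) * tri_reduce i p.
Proof.
rewrite tri_termE /tri_reduce mlin_mulX -mlin_mull; apply: eq_mlin => m.
rewrite mulrA -exprS /block_rem (@block_floor_shift i m _ 1); last first.
  by move=> j; rewrite mnmDE tri_monE eqxx mul1n addnC.
congr (_ ^+ _ * 'X_[_]); first by rewrite addn1.
by rewrite addn1 mulmS -submDA addmC addmK.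
Qed.

Lemma trinomialE i : g = x i + \sum_(k < 3 | k != i) x k.
Proof. by rewrite /trinomial (bigD1 i). Qed.

(** The terms x_k with k different from i are free of block i, so they pass through the reduction
    and cancel the image of x_i. Thus the reduction factors through R(g). *)
Lemma tri_reduce_trinomial i p : tri_reduce i (g * p) = 0.
Proof.
rewrite (trinomialE i) mulrDl linearD /= tri_reduce_term mulNr addrC.
apply/eqP; rewrite subr_eq0 !mulr_suml linear_sum; apply/eqP.
apply: eq_bigr => k ki; rewrite tri_termE /= tri_reduceMX // => j.
by rewrite tri_monE (negPf ki).
Qed.

Lemma tri_proj_eq0 p : pi p = 0 <-> exists q, p = q * g.
Proof.
rewrite -(rmorph0 pi); split.
  by move/eqP; rewrite -Quotient.idealrBE subr0 => /asboolP.
by move=> pg; apply/eqP; rewrite -Quotient.idealrBE subr0; apply/asboolP.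
Qed.

Lemma tri_proj_surj (f : trinomial_algebra K D) : exists p, f = pi p.
Proof. by exists (repr f); rewrite /tri_proj reprK. Qed.

Lemma tri_proj_trinomial : pi g = 0.
Proof. by apply/tri_proj_eq0; exists 1; rewrite mul1r. Qed.

Lemma tri_proj_term i : pi (x i) = - \sum_(k < 3 | k != i) pi (x k).
Proof.
apply/eqP; rewrite -addr_eq0 -rmorph_sum -rmorphD -trinomialE; apply/eqP.
exact: tri_proj_trinomial.
Qed.

Lemma tri_reduce_proj i p : pi (tri_reduce i p) = pi p.
Proof.
elim/mpoly_lin_ind: p => [|p q IHp IHq|a m]; first by rewrite linear0.
  by rewrite linearD /= !rmorphD /= IHp IHq.
rewrite !linearZ /=; congr (_ *: _).
rewrite /tri_reduce mlinX rmorphM rmorphXn rmorphN rmorph_sum /= -tri_proj_term.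
by rewrite -rmorphXn -rmorphM /= tri_termE mpolyXn -mpolyXD block_remK.
Qed.

Lemma tri_reduce_eq i p q : pi p = pi q -> tri_reduce i p = tri_reduce i q.
Proof.
move=> /eqP; rewrite -subr_eq0 -rmorphB => /eqP/tri_proj_eq0[r E].
by apply/eqP; rewrite -subr_eq0 -linearB /= E mulrC tri_reduce_trinomial.
Qed.

Definition block_free i (p : poly) : Prop :=
  forall m, m \in msupp p -> forall j, m (idx i j) = 0%N.

Lemma tri_reduceM i (b p : poly) : block_free i b ->
  tri_reduce i (b * p) = b * tri_reduce i p.
Proof.
move=> bi; rewrite {1}[b]mpolyE mulr_suml linear_sum [in RHS](mpolyE b)
  mulr_suml.
rewrite big_seq [RHS]big_seq; apply: eq_bigr => m mb.
rewrite -!scalerAl linearZ /=; congr (_ *: _); exact/tri_reduceMX/bi.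
Qed.

(** The reduction in block i is linear over polynomials free of that block, so the equation is moved
    to the polynomial ring, which is a domain. *)
Lemma block_free_reg i (b : poly) f : block_free i b -> b != 0 ->
  pi b * f = 0 -> f = 0.
Proof.
have [p ->] := tri_proj_surj f => bi b0; rewrite -rmorphM -(rmorph0 pi).
move/(tri_reduce_eq i); rewrite linear0 tri_reduceM // => /eqP.
rewrite mulf_eq0 (negPf b0) /= => /eqP E.
by rewrite -(tri_reduce_proj i) E.
Qed.

Definition block_supp i b : Prop :=
  forall k, k != i -> forall j, b (idx k j) = 0%N.

Lemma third_index i k : exists r : 'I_3, r != i /\ r != k.
Proof.
by case: i => -[|[|[|//]]] ?; case: k => -[|[|[|//]]] ?;
  do [by exists (@Ordinal 3 0 isT)
     |by exists (@Ordinal 3 1 isT)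
     |by exists (@Ordinal 3 2 isT)].
Qed.

(** Both monomials are free of a third block r. Reducing in block r turns the equation into one
    between polynomials, where coprime monomials can be separated. *)
Lemma block_coprime i k a b u v : i != k -> block_supp i a -> block_supp k b ->
  pi 'X_[a] * u = pi 'X_[b] * v -> exists w, u = pi 'X_[b] * w.
Proof.
move=> ik ai bk; have [r [ri rk]] := third_index i k.
have [U ->] := tri_proj_surj u; have [V ->] := tri_proj_surj v.
rewrite -!rmorphM => /(tri_reduce_eq r); rewrite !tri_reduceMX;
  [|by move=> j; apply: bk|by move=> j; apply: ai].
case/mpolyX_coprime_dvd=> [s|P' E]; last first.
  by exists (pi P'); rewrite -rmorphM -E /= tri_reduce_proj.
have [t [j ->]] := tri_indexP s; have [tk|/bk ->] := eqVneq t k; last by right.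
by left; apply: ai; rewrite tk eq_sym.
Qed.

End TrinomialMonomials.

(** * The fine grading and homogeneous components *)

Section FineGrading.
Variables (K : fieldType) (D : trinomial_data).
Local Notation n := (tri_n D).
Local Notation l := (tri_l D).
Local Notation poly := {mpoly K[tri_dim D]}.
Local Notation mon := ('X_{1..tri_dim D}).
Local Notation idx i j := (@tri_index D i j).
Local Notation g := (@trinomial K D).
Local Notation pi := (@tri_proj K D).
Local Notation R := (trinomial_algebra K D).
Local Notation deg := (@monomial_degree D).
Local Notation hom := (@homogeneous_of_degree K D).
Implicit Types (m b : mon) (i k : 'I_3) (w v : grading_group D) (f h : R).

(** The equation [tagnat.sig2 (idx i j) = j] is ill typed, its sides living in different ordinals;
    the identity is therefore stated through a function of both coordinates. *)
Lemma tagnat_index (T : Type) (F : forall i, 'I_(n i) -> T) i (j : 'I_(n i)) :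
  F (tagnat.sig1 (idx i j)) (tagnat.sig2 (idx i j)) = F i j.
Proof. by rewrite /tagnat.sig1 /tagnat.sig2 /tri_index /tagnat.Rank
  tagnat.rankK. Qed.

Lemma grading_projB (u v : 'cV[int]_(tri_dim D)) :
  grading_proj (u - v) = grading_proj u - grading_proj v.
Proof. exact: (raddfB (\pi_(Quotient.quot (@tri_imL D)))%qT). Qed.
HB.instance Definition _ :=
  GRing.isZmodMorphism.Build _ _ (@grading_proj D) grading_projB.

Lemma monomial_degreeE m : deg m = grading_proj (\col_s (m s)%:Z).
Proof.
rewrite /monomial_degree; under eq_bigr do rewrite -raddfMn /=.
rewrite -raddf_sum /=; congr grading_proj; apply/colP => s.
rewrite summxE (bigD1 s) //= big1 => [|t ts].
  by rewrite mulmxnE !mxE !eqxx addr0 pmulrn -mulrzr mul1r intz.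
by rewrite mulmxnE !mxE eq_sym (negPf ts) mul0rn.
Qed.

Lemma monomial_degreeD m m' : deg (m + m')%MM = deg m + deg m'.
Proof.
rewrite /monomial_degree -big_split; apply: eq_bigr => s _.
by rewrite mnmDE mulrnDr.
Qed.

(** The factor by which l_i is multiplied in the i-th block of the transpose of L applied to v; the
    three factors sum to zero. *)
Definition row_weight (v : 'cV[int]_2) i : int :=
  if i == 0 then - (v 0 0 + v 1 0) else if i == 1 then v 0 0 else v 1 0.

Lemma tri_L_entry (v : 'cV[int]_2) s :
  ((tri_L D)^T *m v) s 0
  = row_weight v (tagnat.sig1 s) * (l (tagnat.sig1 s) (tagnat.sig2 s))%:Z.
Proof.
rewrite mxE !big_ord_recl big_ord0 addr0 !mxE /row_weight.
move: (tagnat.sig1 s) (tagnat.sig2 s) => i j.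
have -> : lift ord0 ord0 = 1 :> 'I_2 by apply: val_inj.
case: i j => -[|[|[|//]]] Hi j /=; rewrite -?val_eqE /=.
- by rewrite -mulrDr mulrC mulrN mulNr.
- by rewrite mul0r addr0 mulrC.
- by rewrite mul0r add0r mulrC.
Qed.

(** The image of the transpose of L consists of the vectors with blocks alpha_i l_i, where the
    alpha_i sum to zero; alpha_1 and alpha_2 are the coordinates of a preimage. *)
Lemma monomial_degreeP m m' :
  deg m = deg m' <-> exists alpha : 'I_3 -> int,
    \sum_(i < 3) alpha i = 0 /\
    forall i j, (m (idx i j))%:Z = (m' (idx i j))%:Z + alpha i * (l i j)%:Z.
Proof.
rewrite !monomial_degreeE; split.
  move/eqP; rewrite /grading_proj -Quotient.idealrBE => /asboolP[v E].
  exists (row_weight v); split.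
    rewrite !big_ord_recl big_ord0 /row_weight /=; ring.
  move=> i j; have := congr1 (fun u : 'cV_ _ => u (idx i j) 0) E.
  rewrite tri_L_entry (tagnat_index (fun i j => row_weight v i * (l i j)%:Z)).
  by rewrite !mxE => <-; ring.
move=> [alpha [alpha0 E]]; apply/eqP; rewrite /grading_proj -Quotient.idealrBE.
apply/asboolP; exists (\col_r if r == 0 then alpha 1 else alpha 2%:R).
apply/colP => s; rewrite tri_L_entry !mxE.
have [i [j sE]] := tri_indexP s; rewrite {1 2}sE E addrC addKr {}sE.
rewrite (tagnat_index (fun i j => row_weight _ i * (l i j)%:Z)).
congr (_ * _); rewrite /row_weight !mxE /=.
move: alpha0; rewrite !big_ord_recl big_ord0 addr0 => /eqP.
have -> : lift ord0 ord0 = 1 :> 'I_3 by apply: val_inj.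
have -> : lift ord0 (lift ord0 ord0) = 2%:R :> 'I_3 by apply: val_inj.
rewrite addr_eq0 => /eqP a0; case: eqVneq => [->|i0]; first by rewrite -a0.
case: eqVneq => [->|i1] //; congr alpha; apply: val_inj.
by case: i i0 i1 {E j} => -[|[|[|//]]].
Qed.

Lemma degree_tri_mon i k : deg (tri_mon D i) = deg (tri_mon D k).
Proof.
apply/monomial_degreeP; exists (fun r => (r == i)%:R - (r == k)%:R); split.
  have S t : \sum_(r < 3) (r == t)%:R = 1 :> int.
    by rewrite (bigD1 t) //= big1 ?addr0 ?eqxx // => r /negPf ->.
  by rewrite sumrB !S subrr.
move=> r j; rewrite !tri_monE ![_ == r]eq_sym.
by do 2!case: eqP => _; rewrite ?subrr ?subr0 ?sub0r ?mul0r ?mul1r ?mulN1r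
  ?addr0 ?add0r ?subrr.
Qed.

Definition poly_component w : poly -> poly :=
  mlin (fun m => if deg m == w then 'X_[m] else 0).
HB.instance Definition _ w := GRing.Linear.on (poly_component w).

Lemma mcoeff_poly_component w p m : (poly_component w p)@_m =
  if deg m == w then p@_m else 0.
Proof.
elim/mpoly_lin_ind: p => [|p q IHp IHq|a m'].
- by rewrite linear0 mcoeff0 if_same.
- by rewrite linearD /= !mcoeffD IHp IHq; case: ifP; rewrite ?addr0.
rewrite linearZ /= /poly_component mlinX !mcoeffZ mcoeffX.
have [<-|mm'] := eqVneq m' m.
  by case: (_ == w); rewrite ?mcoeffX ?eqxx ?mcoeff0 ?mulr0.
by case: (deg m' == w);
  rewrite ?mcoeffX ?(negPf mm') ?mcoeff0 ?mulr0n ?mulr0 ?if_same.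
Qed.

Lemma poly_component_id w p : (forall m, m \in msupp p -> deg m = w) ->
  poly_component w p = p.
Proof.
move=> pw; apply/mpolyP => m; rewrite mcoeff_poly_component; case: eqP => // mw.
by apply/esym/memN_msupp_eq0/negP => /pw.
Qed.

Lemma msupp_poly_component w p m : m \in msupp (poly_component w p) ->
  deg m = w.
Proof.
by rewrite mcoeff_msupp mcoeff_poly_component; case: (deg m =P w);
  rewrite ?eqxx.
Qed.

Lemma poly_component_mulX w b p : poly_component w ('X_[b] * p) =
  'X_[b] * poly_component (w - deg b) p.
Proof.
rewrite /poly_component mlin_mulX -mlin_mull; apply: eq_mlin => m.
rewrite monomial_degreeD addrC -(inj_eq (addIr (- deg b))) addrK.
by case: eqP => _; rewrite ?mpolyXD ?mulr0.
Qed.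

(** Since g is homogeneous, taking components preserves its ideal and so descends to R(g). *)
Lemma poly_component_trinomial w p :
  poly_component w (p * g) = poly_component (w - deg (tri_mon D 0)) p * g.
Proof.
rewrite ![_ * g]mulrC /trinomial !mulr_suml linear_sum; apply: eq_bigr => i _.
by rewrite tri_termE /= poly_component_mulX (degree_tri_mon i 0).
Qed.

Lemma poly_component_mull w v p q : (forall m, m \in msupp p -> deg m = v) ->
  poly_component (v + w) (p * q) = p * poly_component w q.
Proof.
move=> pv; rewrite {1}[p]mpolyE mulr_suml linear_sum [in RHS](mpolyE p)
  mulr_suml.
rewrite big_seq [RHS]big_seq; apply: eq_bigr => m mp.
by rewrite -!scalerAl linearZ /= poly_component_mulX (pv m mp) addrC addKr.
Qed.

Lemma poly_component_decomp p :
  exists2 s : seq (grading_group D), uniq s &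
    p = \sum_(w <- s) poly_component w p.
Proof.
exists (undup [seq deg m | m <- msupp p]); first exact: undup_uniq.
apply/mpolyP => m; rewrite raddf_sum /=;
  under eq_bigr do rewrite mcoeff_poly_component.
have [mp|/memN_msupp_eq0 ->] := boolP (m \in msupp p); last first.
  by rewrite big1 // => w _; rewrite if_same.
rewrite (bigD1_seq (deg m)) ?undup_uniq ?mem_undup ?map_f //= eqxx big1
  ?addr0 //.
by move=> w; rewrite eq_sym => /negPf ->.
Qed.

Definition component w f : R := pi (poly_component w (repr f)).

Lemma component_proj w p : component w (pi p) = pi (poly_component w p).
Proof.
apply/eqP; rewrite -subr_eq0 -rmorphB -linearB; apply/eqP/tri_proj_eq0.
have /tri_proj_eq0[q ->] : pi (repr (pi p) - p) = 0.
  by rewrite rmorphB /= /tri_proj reprK subrr.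
by exists (poly_component (w - deg (tri_mon D 0)) q);
  rewrite /= poly_component_trinomial.
Qed.

Lemma component_is_linear w : linear (component w).
Proof.
move=> a f h; have [p ->] := tri_proj_surj f; have [q ->] := tri_proj_surj h.
by rewrite -linearP !component_proj -!linearP.
Qed.
HB.instance Definition _ w :=
  GRing.isLinear.Build K R R *:%R (component w) (component_is_linear w).

Lemma homogeneous_componentP w f : hom w f <-> component w f = f.
Proof.
split=> [[p pw ->]|<-]; first by rewrite component_proj poly_component_id.
by exists (poly_component w (repr f)) => //; apply: msupp_poly_component.
Qed.

Lemma hom_component w f : hom w (component w f).
Proof. by exists (poly_component w (repr f)) => //;
  apply: msupp_poly_component. Qed.

Lemma component_mull w v f h : hom v f ->
  component (v + w) (f * h) = f * component w h.
Proof.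
have [q ->] := tri_proj_surj h; case=> p pv ->.
by rewrite -rmorphM !component_proj /= (poly_component_mull _ _ pv) rmorphM.
Qed.

Lemma hom_mul w v f h : hom w f -> hom v h -> hom (w + v) (f * h).
Proof. by move=> fw /homogeneous_componentP hv; apply/homogeneous_componentP;
  rewrite (component_mull _ _ fw) hv. Qed.

Lemma component_hom w v f : hom v f -> component w f = if v == w then f else 0.
Proof.
case=> p pv ->; rewrite component_proj; case: eqP => [<-|vw];
  first by rewrite poly_component_id.
suff -> : poly_component w p = 0 by rewrite rmorph0.
apply/mpolyP => m; rewrite mcoeff_poly_component mcoeff0; case: eqP => // mw.
by apply/memN_msupp_eq0/negP => /pv mv; apply: vw; rewrite -mv -mw.
Qed.

Lemma component_decomp f :
  exists2 s : seq (grading_group D), uniq s & f = \sum_(w <- s) component w f.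
Proof.
have [p ->] := tri_proj_surj f; have [s us E] := poly_component_decomp p.
exists s => //; rewrite {1}E rmorph_sum; apply: eq_bigr => w _.
by rewrite component_proj.
Qed.

Lemma hom_mon m : hom (deg m) (pi 'X_[m]).
Proof. by exists 'X_[m] => // m'; rewrite msuppX mem_seq1 => /eqP ->. Qed.

Lemma hom_lin w (a b : K) f h : hom w f -> hom w h -> hom w (a *: f + b *: h).
Proof.
by move=> /homogeneous_componentP fw /homogeneous_componentP hw;
  apply/homogeneous_componentP; rewrite linearD !linearZ /= fw hw.
Qed.

Lemma homogeneousM f h : homogeneous f -> homogeneous h -> homogeneous (f * h).
Proof. by move=> [w fw] [v hv]; exists (w + v); apply: hom_mul. Qed.

End FineGrading.

(** * Binary forms with coefficients taken from a univariate polynomial *)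

Section BinaryForms.
Variables (K : fieldType) (A : comAlgType K) (X Y : A).

(** The homogenization Y^d p(X/Y) of a polynomial of degree at most d. *)
Definition binary_form d (p : {poly K}) : A :=
  \sum_(k < d.+1) p`_k *: (X ^+ k * Y ^+ (d - k)).

Lemma binary_form_is_linear d : linear (binary_form d).
Proof.
move=> a p q; rewrite /binary_form scaler_sumr -big_split /=.
by apply: eq_bigr => k _; rewrite coefD coefZ scalerDl scalerA.
Qed.
HB.instance Definition _ d :=
  GRing.isLinear.Build K {poly K} A *:%R (binary_form d)
    (binary_form_is_linear d).

Lemma binary_formX d p : binary_form d.+1 (p * 'X) = X * binary_form d p.
Proof.
rewrite /binary_form big_ord_recl coefMX /= scale0r add0r mulr_sumr.
by apply: eq_bigr => k _; rewrite coefMX /= -scalerAr mulrA -exprS subSS.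
Qed.

(** The only term without a factor Y carries the coefficient of degree d + 1, which vanishes. *)
Lemma binary_formY d (p : {poly K}) : (size p <= d.+1)%N ->
  binary_form d.+1 p = Y * binary_form d p.
Proof.
move=> pd; rewrite /binary_form big_ord_recr /= nth_default // scale0r addr0.
rewrite mulr_sumr; apply: eq_bigr => k _.
by rewrite -scalerAr mulrCA -exprS subSn // -ltnS.
Qed.

Definition is_form d (f : A) : Prop :=
  exists2 p : {poly K}, (size p <= d.+1)%N & f = binary_form d p.

Lemma is_form1 : is_form 0 1.
Proof.
exists 1; first by rewrite size_poly1.
by rewrite /binary_form big_ord_recl big_ord0 coef1 scale1r mulr1 addr0.
Qed.

Lemma is_form_lin d a f h : is_form d f -> is_form d h ->
  is_form d (a *: f + h).
Proof.
move=> [p pd ->] [q qd ->]; exists (a *: p + q); last by rewrite linearP.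
rewrite (leq_trans (size_polyD _ _)) // geq_max qd andbT.
exact: leq_trans (size_scale_leq _ _) pd.
Qed.

Lemma is_form0 d : is_form d 0.
Proof. by exists 0; rewrite ?size_poly0 // linear0. Qed.

Lemma is_form_mulX d f : is_form d f -> is_form d.+1 (X * f).
Proof.
move=> [p pd ->]; exists (p * 'X); last by rewrite binary_formX.
by have [->|p0] := eqVneq p 0; rewrite ?mul0r ?size_poly0 // size_mulX.
Qed.

Lemma is_form_mulY d f : is_form d f -> is_form d.+1 (Y * f).
Proof. by move=> [p pd ->]; exists p;
  rewrite ?binary_formY // (leq_trans pd). Qed.

Lemma is_form_mul_lin d a b f : is_form d f ->
  is_form d.+1 ((a *: X + b *: Y) * f).
Proof.
move=> fd; rewrite mulrDl -!scalerAl; apply: is_form_lin (is_form_mulX fd) _.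
by rewrite -[_ *: _]addr0; apply: is_form_lin (is_form_mulY fd) (is_form0 _).
Qed.

Lemma is_form_mul_expr_lin d e a b f : is_form d f ->
  is_form (e + d) ((a *: X + b *: Y) ^+ e * f).
Proof.
move=> fd; elim: e => [|e IHe]; first by rewrite mul1r.
by rewrite exprS -mulrA; apply: is_form_mul_lin.
Qed.

End BinaryForms.

(** * Homogeneous elements as monomials times binary forms in x_0, x_1 *)

Section HomogeneousProducts.
Variables (K : fieldType) (D : trinomial_data).
Local Notation n := (tri_n D).
Local Notation l := (tri_l D).
Local Notation mon := ('X_{1..tri_dim D}).
Local Notation idx i j := (@tri_index D i j).
Local Notation x i := (@tri_term K D i).
Local Notation pi := (@tri_proj K D).
Local Notation R := (trinomial_algebra K D).
Local Notation deg := (@monomial_degree D).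
Local Notation hom := (@homogeneous_of_degree K D).
Implicit Types (m : mon) (i k : 'I_3) (w v : grading_group D) (f h : R).

Definition linear_form (a b : K) : R := a *: pi (x 0) + b *: pi (x 1).

(** The constant may be 0, so that 0 is included; the linear forms are nonzero so that each of them
    is regular. *)
Inductive homogeneous_product : R -> Prop :=
| hprod_const c : homogeneous_product c%:A
| hprod_var s f : homogeneous_product f -> homogeneous_product (pi 'X_s * f)
| hprod_linear a b f : (a != 0) || (b != 0) -> homogeneous_product f ->
    homogeneous_product (linear_form a b * f).

Lemma hprod_mon m f :
  homogeneous_product f -> homogeneous_product (pi 'X_[m] * f).
Proof.
move=> hf; rewrite mpolyXE_id.
elim/big_rec: _ => [|s p _ IHp]; first by rewrite rmorph1 mul1r.
elim: (m s) => [|e IHe]; first by rewrite mul1r.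
by rewrite exprS -mulrA rmorphM -mulrA; apply: hprod_var.
Qed.

Lemma tri_proj_term_linear i : exists a b, pi (x i) = linear_form a b.
Proof.
case: i => -[|[|[|//]]] Hi; set i := Ordinal _.
- exists 1, 0; rewrite /linear_form scale0r scale1r addr0.
  by congr (pi (x _)); apply: val_inj.
- exists 0, 1; rewrite /linear_form scale0r scale1r add0r.
  by congr (pi (x _)); apply: val_inj.
exists (-1), (-1); rewrite tri_proj_term !big_mkcond /= !big_ord_recl big_ord0.
rewrite /= addr0 addr0 /linear_form !scaleN1r opprD.
by congr (- pi (x _) - pi (x _)); apply: val_inj.
Qed.

Lemma tri_mon_combE (e : 'I_3 -> nat) k (j : 'I_(n k)) :
  (\sum_(i < 3) tri_mon D i *+ e i)%MM (idx k j) = (e k * l k j)%N.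
Proof.
rewrite mnm_sumE (bigD1 k) //= mulmnE tri_monE eqxx big1 ?addn0 1?mulnC //.
by move=> i /negPf ik; rewrite mulmnE tri_monE ik mul0n.
Qed.

Lemma block_floor_degree m m' (alpha : 'I_3 -> int) i :
    (forall j, (m (idx i j))%:Z = (m' (idx i j))%:Z + alpha i * (l i j)%:Z) ->
  (block_floor i m)%:Z = (block_floor i m')%:Z + alpha i.
Proof.
case: (alpha i) => e E.
  rewrite (@block_floor_shift _ i m' m e) ?PoszD // => j.
  by apply/eqP; rewrite -eqz_nat PoszD PoszM E.
rewrite (@block_floor_shift _ i m m' e.+1) ?PoszD ?NegzE ?addrK // => j.
by apply/eqP; rewrite -eqz_nat PoszD PoszM E NegzE mulNr subrK.
Qed.

Lemma is_form_monomial d (e : 'I_3 -> nat) : (\sum_(i < 3) e i = d)%N ->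
  is_form (pi (x 0)) (pi (x 1)) d (\prod_(i < 3) pi (x i) ^+ e i).
Proof.
move=> <-; elim/big_rec2: _ => [|i d' f _ IH]; first exact: is_form1.
have [a [b ->]] := tri_proj_term_linear i.
exact: is_form_mul_expr_lin.
Qed.

(** Monomials of equal degree differ in block i by alpha_i l_i with the alpha_i summing to zero. So
    they share the part u left after removing all powers of the x_i, and the total number d of
    removed factors. *)
Lemma homogeneous_is_form w f : hom w f -> exists m d f',
  f = pi 'X_[m] * f' /\ is_form (pi (x 0)) (pi (x 1)) d f'.
Proof.
case=> p pw ->; have [->|] := eqVneq p 0.
  exists 0%MM, 0%N, 0; split; last exact: is_form0.
  by rewrite mulr0 rmorph0.
rewrite -msupp_eq0; case E: (msupp p) => [//|m0 s] _.
have {s E} m0p : m0 \in msupp p by rewrite E mem_head.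
pose u := (m0 - \sum_(i < 3) tri_mon D i *+ block_floor i m0)%MM.
pose d := (\sum_(i < 3) block_floor i m0)%N.
have mP m : m \in msupp p ->
    m = (u + \sum_(i < 3) tri_mon D i *+ block_floor i m)%MM /\
    (\sum_(i < 3) block_floor i m = d)%N.
  move=> /pw; rewrite -(pw _ m0p) => /monomial_degreeP[alpha [alpha0 mE]].
  have fE i := block_floor_degree (mE i).
  split.
    apply: tri_mnmP => i j; rewrite mnmDE mnmBE !tri_mon_combE.
    apply/eqP; rewrite -eqz_nat PoszD mE -subzn; last exact/block_floorP.
    by rewrite !PoszM fE; apply/eqP; ring.
  apply/eqP; rewrite -eqz_nat -!natz /d !natr_sum; apply/eqP.
  under eq_bigr do rewrite natz fE; rewrite big_split /= alpha0 addr0.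
  by apply: eq_bigr => i _; rewrite natz.
exists u, d,
  (\sum_(m <- msupp p) p@_m *: \prod_(i < 3) pi (x i) ^+ block_floor i m).
split.
  rewrite {1}[p]mpolyE rmorph_sum mulr_sumr big_seq [RHS]big_seq.
  apply: eq_bigr => m mp; rewrite /= linearZ -scalerAr /=; congr (_ *: _).
  rewrite {1}(mP m mp).1 mpolyXD rmorphM -mprodXnE rmorph_prod; congr (_ * _).
  by apply: eq_bigr => i _; rewrite tri_termE rmorphXn.
rewrite big_seq; elim/big_ind: _ => [|f1 f2 H1 H2|m mp]; first exact: is_form0.
  by rewrite -[f1]scale1r; apply: is_form_lin.
rewrite -[_ *: _]addr0; apply: is_form_lin; last exact: is_form0.
by apply: is_form_monomial; case: (mP m mp).
Qed.

Lemma homogeneous_linear_form a b : hom (deg (tri_mon D 0)) (linear_form a b).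
Proof.
apply: hom_lin; rewrite tri_termE; last rewrite -(degree_tri_mon D 1 0);
  exact: hom_mon.
Qed.

Lemma hprod_homogeneous f : homogeneous_product f -> homogeneous f.
Proof.
elim=> [c|s f' _ [w fw]|a b f' _ _ [w fw]].
- exists 0; exists c%:MP.
    move=> m; rewrite msuppC; case: ifP => // _; rewrite mem_seq1 => /eqP ->.
    by rewrite /monomial_degree big1 // => s _; rewrite mnm0E.
  by rewrite -alg_mpolyC linearZ rmorph1.
- by exists (deg U_(s)%MM + w); apply: hom_mul fw; apply: hom_mon.
by eexists; apply: hom_mul fw; apply: homogeneous_linear_form.
Qed.

Lemma tri_mon_neq i k : i != k -> tri_mon D i != tri_mon D k.
Proof.
move=> /negPf ik; pose j := Ordinal (tri_n_gt0 D i).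
apply: contraFneq (ltnn 0) => /(congr1 (fun m : mon => m (idx i j))).
by rewrite !tri_monE eqxx eq_sym ik => E; rewrite -{2}E tri_l_gt0.
Qed.

(** The form involves only the blocks 0 and 1, so it is free of block 2. *)
Lemma linear_form_reg a b f : (a != 0) || (b != 0) ->
  linear_form a b * f = 0 -> f = 0.
Proof.
move=> ab; rewrite /linear_form -!linearZ -rmorphD /=.
have H01 : (tri_mon D 0 == tri_mon D 1) = false.
  by apply/negbTE; apply: tri_mon_neq.
apply: (@block_free_reg _ _ 2%:R).
  move=> m /msuppD_le; rewrite mem_cat => /orP[]/msuppZ_le;
    by rewrite tri_termE msuppX mem_seq1 => /eqP -> j; rewrite tri_monE.
apply: contraTneq ab => E; rewrite negb_or !negbK.
have := congr1 (mcoeff (tri_mon D 0)) E;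
  have := congr1 (mcoeff (tri_mon D 1)) E.
rewrite !tri_termE !mcoeffD !mcoeffZ !mcoeffX !mcoeff0 !eqxx H01 eq_sym H01.
by rewrite !mulr0n !mulr0 add0r addr0 !mulr1 => -> ->; rewrite eqxx.
Qed.

Lemma mon_reg i m f : block_supp i m -> pi 'X_[m] * f = 0 -> f = 0.
Proof.
move=> mi; have [r [ri _]] := third_index i i.
apply: (@block_free_reg _ _ r); last by rewrite -msupp_eq0 msuppX.
by move=> m'; rewrite msuppX mem_seq1 => /eqP -> j; apply: mi.
Qed.

Lemma block_suppU i (j : 'I_(n i)) : block_supp i U_(idx i j)%MM.
Proof. by move=> k ki j'; rewrite mnm1_idx eq_sym (negPf ki). Qed.

Lemma hprod_reg f h : homogeneous_product f -> f != 0 -> f * h = 0 -> h = 0.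
Proof.
elim=> [c|s f' _ IH|a b f' ab _ IH] f0.
- rewrite -scalerAl mul1r => /eqP; rewrite scaler_eq0 => /orP[/eqP c0|/eqP //].
  by rewrite c0 scale0r eqxx in f0.
- rewrite -mulrA; have [i [j ->]] := tri_indexP s;
  move/(mon_reg (@block_suppU i j)); apply: IH.
  by apply: contra_neq f0 => ->; rewrite mulr0.
rewrite -mulrA => /(linear_form_reg ab); apply: IH.
by apply: contra_neq f0 => ->; rewrite mulr0.
Qed.

End HomogeneousProducts.

(** * Factorization of homogeneous elements over an algebraically closed field *)

Section Factorization.
Variables (K : closedFieldType) (D : trinomial_data).
Local Notation x i := (@tri_term K D i).
Local Notation pi := (@tri_proj K D).

(** Each induction step splits off one linear factor: x_1 if the top coefficient is missing,
    otherwise x_0 - r x_1 for a root r of p. *)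
Lemma binary_form_hprod d (p : {poly K}) : (size p <= d.+1)%N ->
  homogeneous_product (binary_form (pi (x 0)) (pi (x 1)) d p).
Proof.
elim: d p => [|d IHd] p pd.
  rewrite /binary_form big_ord_recl big_ord0 addr0 mulr1; exact: hprod_const.
have [pd'|] := leqP (size p) d.+1.
  have E : pi (x 1) = linear_form D 0 1.
    by rewrite /linear_form scale0r scale1r add0r.
  rewrite binary_formY // {1}E.
  by apply: hprod_linear; [rewrite oner_eq0 orbT|apply: IHd].
move=> dp; have /closed_rootP[r] : size p != 1.
  by apply: contraTneq dp => ->; rewrite -leqNgt.
case/factor_theorem => q pE.
have qd : (size q <= d.+1)%N.
  have [->|q0] := eqVneq q 0; first by rewrite size_poly0.
  by move: pd; rewrite pE size_Mmonic ?monicXsubC // size_XsubC addn2.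
rewrite pE mulrBr linearB /= binary_formX -[q * _]mulrC mul_polyC linearZ /=.
rewrite binary_formY // scalerAl -mulrBl -scaleNr.
have -> : pi (x 0) + - r *: pi (x 1) = linear_form D 1 (- r).
  by rewrite /linear_form scale1r.
by apply: hprod_linear; [rewrite oner_eq0|apply: IHd].
Qed.

Lemma homogeneousP (f : trinomial_algebra K D) :
  homogeneous f <-> homogeneous_product f.
Proof.
split=> [[w /homogeneous_is_form[m [d [f' [-> [p pd ->]]]]]]|].
  exact/hprod_mon/binary_form_hprod.
exact: hprod_homogeneous.
Qed.

Lemma homogeneous_reg (f h : trinomial_algebra K D) :
  homogeneous f -> f != 0 -> f * h = 0 -> h = 0.
Proof. by move/homogeneousP; apply: hprod_reg. Qed.

(** The difference between h and its component of degree v - w is annihilated by the regular element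
    f. *)
Lemma homogeneous_div (f h : trinomial_algebra K D) :
  homogeneous f -> f != 0 -> homogeneous (f * h) -> homogeneous h.
Proof.
move=> hf f0 [v fhv]; have [w fw] := hf.
exists (v - w); apply/homogeneous_componentP/eqP; rewrite -subr_eq0; apply/eqP.
apply: (homogeneous_reg hf f0); rewrite mulrBr -(component_mull _ _ fw).
by rewrite [w + _]addrC subrK; apply/eqP; rewrite subr_eq0 eq_sym;
  apply/eqP/esym/homogeneous_componentP.
Qed.

End Factorization.

(** * Derivations from polynomials to R(g) and Euler derivations *)

Section PolynomialDerivations.
Variables (K : fieldType) (D : trinomial_data).
Local Notation n := (tri_n D).
Local Notation l := (tri_l D).
Local Notation poly := {mpoly K[tri_dim D]}.
Local Notation mon := ('X_{1..tri_dim D}).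
Local Notation idx i j := (@tri_index D i j).
Local Notation x i := (@tri_term K D i).
Local Notation pi := (@tri_proj K D).
Local Notation R := (trinomial_algebra K D).
Implicit Types (m : mon) (i k : 'I_3) (f h : R).

(** R(g) is regarded as a module over the polynomial ring through [pi]; two such derivations can be
    compared on the variables alone. *)
Definition is_poly_derivation (phi : poly -> R) : Prop :=
  linear phi /\ forall p q, phi (p * q) = phi p * pi q + pi p * phi q.

Lemma eq_poly_derivation phi psi :
    is_poly_derivation phi -> is_poly_derivation psi ->
  (forall s, phi 'X_s = psi 'X_s) -> phi =1 psi.
Proof.
move=> [phiL phiM] [psiL psiM] E.
have phi0 : phi 0 = 0.
  by have := phiL (-1) 0 0; rewrite scaler0 add0r scaleN1r addNr.
have psi0 : psi 0 = 0.
  by have := psiL (-1) 0 0; rewrite scaler0 add0r scaleN1r addNr.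
have E1 : phi 1 = psi 1.
  have := phiM 1 1; have := psiM 1 1; rewrite !mulr1 rmorph1 !mul1r !mulr1.
  by move=> /eqP; rewrite -[X in X == _]addr0 (inj_eq (addrI _)) => /eqP <-
    /eqP; rewrite -[X in X == _]addr0 (inj_eq (addrI _)) => /eqP <-.
apply: mpoly_lin_ind => [|p q IHp IHq|a m]; first by rewrite phi0 psi0.
  by rewrite -[p]scale1r phiL psiL IHp IHq.
rewrite -[a *: _]addr0 phiL psiL phi0 psi0 mpolyXE_id; congr (_ *: _ + _).
elim/big_rec: _ => // s p _ IHp.
elim: (m s) => [|e IHe]; first by rewrite mul1r.
by rewrite exprS -mulrA phiM psiM IHe E.
Qed.

Lemma derivation_proj (delta : {linear R -> R}) : is_derivation delta ->
  is_poly_derivation (delta \o pi).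
Proof.
move=> delta_der; split=> [a p q|p q] /=; first by rewrite !linearP.
by rewrite rmorphM delta_der.
Qed.

Lemma mderiv_lincomb_is_poly_derivation I (r : seq I) (s : I -> 'I_(tri_dim D))
    (v : I -> R) :
  is_poly_derivation (fun p => \sum_(t <- r) pi p^`M(s t) * v t).
Proof.
split=> [a p q|p q].
  rewrite scaler_sumr -big_split; apply: eq_bigr => t _ /=.
  by rewrite linearP linearP mulrDl scalerAl.
rewrite mulr_suml mulr_sumr -big_split; apply: eq_bigr => t _ /=.
by rewrite mderivM rmorphD !rmorphM /=; ring.
Qed.

Definition euler_poly (c : 'I_(tri_dim D) -> K) (p : poly) : poly :=
  \sum_s c s *: ('X_s * p^`M(s)).

Lemma euler_poly_is_linear c : linear (euler_poly c).
Proof.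
move=> a p q; rewrite /euler_poly scaler_sumr -big_split; apply: eq_bigr => s _.
by rewrite /= linearP mulrDr scalerDr -scalerAr !scalerA mulrC.
Qed.
HB.instance Definition _ c :=
  GRing.isLinear.Build K poly poly *:%R (euler_poly c) (euler_poly_is_linear c).

Lemma euler_polyM c p q :
  euler_poly c (p * q) = euler_poly c p * q + p * euler_poly c q.
Proof.
rewrite /euler_poly mulr_suml mulr_sumr -big_split; apply: eq_bigr => s _ /=.
rewrite mderivM mulrDr scalerDr -!scalerAl -!scalerAr.
by congr (_ *: _ + _ *: _); ring.
Qed.

Lemma euler_polyX c m :
  euler_poly c 'X_[m] = (\sum_s c s * (m s)%:R) *: 'X_[m].
Proof.
rewrite scaler_suml; apply: eq_bigr => s _.
rewrite mderivX -scalerAr scalerA; have [-> | ms] := posnP (m s).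
  by rewrite !mulr0 !scale0r.
by rewrite -mpolyXD addmC submK // lep1mP -lt0n.
Qed.

Lemma euler_poly_var c s : euler_poly c 'X_s = c s *: 'X_s.
Proof.
rewrite euler_polyX (bigD1 s) //= mnm1E eqxx mulr1 big1 ?addr0 // => t ts.
by rewrite mnm1E eq_sym (negPf ts) mulr0.
Qed.

Section Weight.
Variables (c : 'I_(tri_dim D) -> K) (lambda : K).
Hypothesis cl : forall i, \sum_(j < n i) c (idx i j) * (l i j)%:R = lambda.

Lemma euler_poly_term i : euler_poly c (x i) = lambda *: x i.
Proof.
rewrite tri_termE euler_polyX -(cl i); congr (_ *: _).
pose w (m : mon) := \sum_s c s * (m s)%:R.
have wD : {morph w : m m' / (m + m')%MM >-> m + m'}.
  move=> m m'; rewrite /w -big_split; apply: eq_bigr => s _.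
  by rewrite mnmDE natrD mulrDr.
have w0 : w 0%MM = 0 by rewrite /w big1 // => s _; rewrite mnm0E mulr0.
rewrite -/(w _) /tri_mon (big_morph w wD w0); apply: eq_bigr => j _.
rewrite /w (bigD1 (idx i j)) //= mulmnE mnm1E eqxx mul1n big1 ?addr0 // => s si.
by rewrite mulmnE mnm1E eq_sym (negPf si) mul0n mulr0.
Qed.

Definition euler f : R := pi (euler_poly c (repr f)).

(** All x_i have the same weight lambda, so g is an eigenvector and its ideal is preserved. *)
Lemma euler_proj p : euler (pi p) = pi (euler_poly c p).
Proof.
apply/eqP; rewrite -subr_eq0 -rmorphB -linearB; apply/eqP/tri_proj_eq0.
have /tri_proj_eq0[q ->] : pi (repr (pi p) - p) = 0.
  by rewrite rmorphB /= /tri_proj reprK subrr.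
exists (euler_poly c q + lambda *: q); rewrite /= euler_polyM mulrDl.
congr (_ + _); rewrite /trinomial linear_sum !mulr_sumr.
by apply: eq_bigr => i _; rewrite /= euler_poly_term -scalerAl -scalerAr.
Qed.

Lemma eulerD f h : euler (f + h) = euler f + euler h.
Proof.
have [p ->] := tri_proj_surj f; have [q ->] := tri_proj_surj h.
by rewrite -rmorphD !euler_proj -rmorphD /= linearD.
Qed.

Lemma eulerZ a f : euler (a *: f) = a *: euler f.
Proof. by have [p ->] := tri_proj_surj f;
  rewrite -linearZ !euler_proj !linearZ. Qed.

Lemma eulerM f h : euler (f * h) = euler f * h + f * euler h.
Proof.
have [p ->] := tri_proj_surj f; have [q ->] := tri_proj_surj h.
by rewrite -rmorphM !euler_proj -!rmorphM -rmorphD /= euler_polyM.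
Qed.

Lemma euler_var s : euler (pi 'X_s) = c s *: pi 'X_s.
Proof. by rewrite euler_proj euler_poly_var linearZ. Qed.

Lemma euler_term i : euler (pi (x i)) = lambda *: pi (x i).
Proof. by rewrite euler_proj euler_poly_term linearZ. Qed.

Lemma euler_linear_form a b :
  euler (linear_form D a b) = lambda *: linear_form D a b.
Proof.
rewrite /linear_form eulerD !eulerZ !euler_term scalerDr !scalerA.
by rewrite ![lambda * _]mulrC.
Qed.

End Weight.
End PolynomialDerivations.

(** * Finely homogeneous locally nilpotent derivations of R(g) *)

Section HomogeneousLND.
Variables (K : closedFieldType) (D : trinomial_data).
Local Notation n := (tri_n D).
Local Notation l := (tri_l D).
Local Notation mon := ('X_{1..tri_dim D}).
Local Notation idx i j := (@tri_index D i j).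
Local Notation x i := (@tri_term K D i).
Local Notation pi := (@tri_proj K D).
Local Notation R := (trinomial_algebra K D).
Local Notation deg := (@monomial_degree D).
Local Notation hom := (@homogeneous_of_degree K D).
Local Notation T i j := (pi 'X_(idx i j)).
Implicit Types (m : mon) (i k : 'I_3) (w v : grading_group D) (f h : R).

Hypothesis charK0 : [pchar K] =i pred0.
Variable delta : {linear R -> R}.
Hypothesis delta_der : is_derivation delta.
Hypothesis delta_lnd : locally_nilpotent delta.
Hypothesis delta_homog : finely_homogeneous delta.

Let reg := @homogeneous_reg K D.
Let factor_closed f h := @ker_factor_closed K R delta charK0 delta_der delta_lnd
  (@homogeneous K D) delta_homog reg f h.
Let cross f h a b := @dvd_delta_cross K R delta charK0 delta_der delta_lnd
  (@homogeneous K D) delta_homog reg (@homogeneous_div K D) f h a b.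
Let self f h := @dvd_delta K R delta charK0 delta_der delta_lnd
  (@homogeneous K D) delta_homog reg (@homogeneous_div K D) f h.

Lemma homogeneous_mon m : homogeneous (pi 'X_[m]).
Proof. by exists (deg m); apply: hom_mon. Qed.

Lemma homogeneous_term i : homogeneous (pi (x i)).
Proof. by rewrite tri_termE; apply: homogeneous_mon. Qed.

Lemma mon_neq0 i m : block_supp i m -> pi 'X_[m] != 0.
Proof.
move=> mi; apply/eqP => E; have /eqP := oner_neq0 R; apply.
by apply: (mon_reg mi); rewrite E mul0r.
Qed.

Lemma block_supp_term i : block_supp i (tri_mon D i).
Proof. by move=> k ki j; rewrite tri_monE eq_sym (negPf ki). Qed.

Lemma var_neq0 i (j : 'I_(n i)) : T i j != 0.
Proof. exact/mon_neq0/block_suppU. Qed.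

Lemma term_neq0 i : pi (x i) != 0.
Proof. by rewrite tri_termE; apply/mon_neq0/block_supp_term. Qed.

Lemma delta_factor0 f h : homogeneous f -> homogeneous h ->
  f * h != 0 -> delta (f * h) = 0 -> delta f = 0 /\ delta h = 0.
Proof.
move=> hf hh fh0 d0; split; first exact: (factor_closed hf hh).
by apply: (factor_closed hh hf); rewrite mulrC.
Qed.

Lemma delta_var_term i j : delta (pi (x i)) = 0 -> delta (T i j) = 0.
Proof.
have E : pi (x i) = T i j * pi 'X_[tri_mon D i - U_(idx i j)].
  rewrite -rmorphM -mpolyXD addmC submK ?tri_termE // lep1mP tri_monE eqxx.
  by rewrite -lt0n tri_l_gt0.
have := term_neq0 i; rewrite E => H0 d0.
by case: (delta_factor0 (homogeneous_mon _) (homogeneous_mon _) H0 d0).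
Qed.

Lemma delta_chain (c : forall i, 'I_(n i)) :
    (forall i j, j != c i -> delta (T i j) = 0) ->
  forall p, delta (pi p)
    = \sum_(i < 3) pi p^`M(idx i (c i)) * delta (T i (c i)).
Proof.
move=> d0; apply: (eq_poly_derivation (derivation_proj delta_der)).
  exact: mderiv_lincomb_is_poly_derivation.
move=> s; have [i [j ->]] := tri_indexP s;
  rewrite (bigD1 i) //= big1 => [|k ki].
  rewrite addr0 (mderiv_tri_var K j (c i)) eq_tri_index eqxx /=.
  have [->|jc] := eqVneq j (c i); first by rewrite eqxx rmorph1 mul1r.
  by rewrite val_eqE (negPf jc) rmorph0 mul0r d0.
rewrite (mderiv_tri_var K j (c k)) eq_tri_index eq_sym (negPf ki).
by rewrite rmorph0 mul0r.
Qed.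

Lemma homogeneousZ (a : K) f : homogeneous f -> homogeneous (a *: f).
Proof.
move=> [w fw]; exists w.
by rewrite -[_ *: _]addr0 -(scale0r f); apply: hom_lin.
Qed.

Lemma block_prod_cancel i (r : seq 'I_3) (d : 'I_3 -> mon) f h : i \notin r ->
    (forall k, block_supp k (d k)) ->
    pi 'X_[d i] * f = pi (\prod_(k <- r) 'X_[d k]) * h ->
  exists u, h = pi 'X_[d i] * u.
Proof.
move=> + ds; elim: r => [|k r IHr] in f *.
  by move=> _; rewrite big_nil rmorph1 mul1r => <-; exists f.
rewrite inE negb_or big_cons rmorphM -mulrA => /andP[ik ir] /esym E.
rewrite eq_sym in ik; have [u /esym uE] := block_coprime ik (ds k) (ds i) E.
exact: IHr uE.
Qed.

(** Monomials in distinct blocks are coprime, so their separate divisibilities of f combine into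
    that of the product. *)
Lemma block_prod_dvd (r : seq 'I_3) (d : 'I_3 -> mon) f : uniq r ->
    (forall k, block_supp k (d k)) ->
    (forall k, k \in r -> exists u, f = pi 'X_[d k] * u) ->
  exists u, f = pi (\prod_(k <- r) 'X_[d k]) * u.
Proof.
move=> + ds; elim: r => [|i r IHr] /=.
  by move=> _ _; exists f; rewrite big_nil rmorph1 mul1r.
move=> /andP[ir ur] dvd; have [|u uE] := IHr ur.
  by move=> k kr; apply: dvd; rewrite inE kr orbT.
have [v vE] := dvd i (mem_head _ _).
have [u' u'E] := block_prod_cancel ir ds (etrans (esym vE) uE).
by exists u'; rewrite big_cons rmorphM /= -mulrA mulrCA -u'E.
Qed.

(** * Nonzero derivations: kernel, active variables, elementary form *)

Section Nonzero.
Variable f0 : R.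
Hypothesis delta_f0 : delta f0 != 0.

Lemma delta_var_neq0 : exists i j, delta (T i j) != 0.
Proof.
apply: contrapT => no.
have Z i j : delta (T i j) = 0.
  by apply/eqP; apply: contraPT no => d; apply; exists i, j.
move/eqP: delta_f0; apply; have [p ->] := tri_proj_surj f0.
rewrite (@delta_chain (fun i => Ordinal (tri_n_gt0 D i))) => [|i j _ //].
by rewrite big1 // => i _; rewrite Z mulr0.
Qed.

(* For a variable t with delta t <> 0, the two terms of
   delta (f t) = delta f t + f delta t must have the same degree. *)
Lemma delta_degree : exists w0, forall w f, hom w f -> hom (w + w0) (delta f).
Proof.
have [i [j dT]] := delta_var_neq0; set t := T i j in dT.
have [v tv] := delta_homog (homogeneous_mon U_(idx i j)).
pose t0 := deg U_(idx i j)%MM; have tt0 : hom t0 t by apply: hom_mon.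
exists (v - t0) => w f fw.
have [df0|df] := eqVneq (delta f) 0.
  by rewrite df0; apply/homogeneous_componentP; rewrite linear0.
have [v' fv'] := delta_homog (ex_intro _ w fw).
have f_neq0 : f != 0 by apply: contra_neq df => ->; rewrite linear0.
have A0 : delta f * t != 0.
  rewrite mulrC; apply: contra_neq df; apply: reg; first by exists t0.
  exact: var_neq0.
have B0 : f * delta t != 0.
  by apply: contra_neq dT; apply: reg f_neq0; exists w.
have hA : hom (v' + t0) (delta f * t) by apply: hom_mul.
have hB : hom (w + v) (f * delta t) by apply: hom_mul.
have [u] := delta_homog (homogeneousM (ex_intro _ w fw) (ex_intro _ t0 tt0)).
rewrite delta_der => hS.
suff E : v' + t0 = w + v by rewrite addrA -E addrK.
(* If the degrees differed, the homogeneous element [delta (f * t)] would have two nonzero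
   components. *)
apply/eqP; apply: contraT => /negPf ne; have ne' := ne; rewrite eq_sym in ne'.
have := component_hom (v' + t0) hS; have := component_hom (w + v) hS.
rewrite !linearD /= !(component_hom _ hA) !(component_hom _ hB) !eqxx ne ne'
  add0r addr0.
case: eqP => [-> _|_ B]; last by rewrite B eqxx in B0.
by rewrite ne' => A; rewrite A eqxx in A0.
Qed.

(** Since [delta] shifts all degrees by w0, the image of the component of degree w is the component
    of [delta f] of degree w + w0. *)
Lemma delta_component f w : delta f = 0 -> delta (component w f) = 0.
Proof.
have [w0 dw0] := delta_degree => df.
have [s us E] := component_decomp f.
have [ws|ws] := boolP (w \in s); last first.
  suff -> : component w f = 0 by rewrite linear0.
  rewrite E linear_sum big_seq big1 // => v vs.
  rewrite /= (component_hom _ (hom_component v f)); case: eqP => // vw.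
  by rewrite -vw vs in ws.
have := congr1 (component (w + w0)) df;
  rewrite linear0 {1}E linear_sum linear_sum.
rewrite (bigD1_seq w) //= big1 ?addr0.
  by rewrite /= (component_hom _ (dw0 _ _ (hom_component w f))) eqxx.
move=> v vw; rewrite /= (component_hom _ (dw0 _ _ (hom_component v f))).
by rewrite (inj_eq (addIr w0)) (negPf vw).
Qed.

(** Then x_2 is killed as well, and closure of the kernel under factors kills every variable. *)
Lemma delta_terms_neq0 :
  delta (pi (x 0)) = 0 -> delta (pi (x 1)) = 0 -> False.
Proof.
move=> d0 d1; have [i [j /eqP]] := delta_var_neq0; apply; apply: delta_var_term.
have [a [b ->]] := @tri_proj_term_linear K D i.
by rewrite linearD !linearZ /= d0 d1 !scaler0 addr0.
Qed.

(** This says that x_1 / x_0 is not a constant of [delta]. Otherwise, x_0 and x_1 being coprime,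
    each would divide its own derivative, and both derivatives would vanish. *)
Lemma delta_not_fiber :
  pi (x 0) * delta (pi (x 1)) != pi (x 1) * delta (pi (x 0)).
Proof.
have dvd i k : i != k -> pi (x i) * delta (pi (x k)) =
  pi (x k) * delta (pi (x i)) ->
    delta (pi (x k)) = 0.
  move=> ik E; have [|h] := @block_coprime K D i k _ _ (delta (pi (x k)))
    (delta (pi (x i))) ik (@block_supp_term i) (@block_supp_term k).
    by rewrite -!tri_termE.
  by rewrite -tri_termE; apply: self; apply: homogeneous_term.
by apply/negP => /eqP E; apply: delta_terms_neq0;
  apply: dvd (esym E) || apply: dvd E.
Qed.

(* The kernel of delta is graded, and its homogeneous elements are products of
   variables and linear forms in x_0, x_1 that lie in the kernel. *)
Lemma euler_ker_prop (c : 'I_(tri_dim D) -> K) lambda :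
    (forall i, \sum_(j < n i) c (idx i j) * (l i j)%:R = lambda) ->
    (forall s, delta (pi 'X_s) = 0 -> c s = 0) ->
    (forall a b, (a != 0) || (b != 0) -> delta (linear_form D a b) = 0 ->
      lambda = 0) ->
  exists s, [/\ homogeneous s, delta s != 0
    & forall f, delta s * euler c f = euler c s * delta f].
Proof.
move=> cl cker lker; have [i [j dT]] := delta_var_neq0.
have [s [hs ds dds]] :=
  local_slice_exists delta_lnd delta_homog (homogeneous_mon U_(idx i j)) dT.
exists s; split=> //; apply: (derivation_ker_prop charK0 delta_der delta_lnd
  delta_homog reg) => //; [exact: eulerD cl|exact: eulerM cl|].
have E0 : euler c 0 = 0 by have := eulerZ cl 0 0; rewrite !scale0r.
have hker f : homogeneous_product f -> delta f = 0 -> euler c f = 0.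
  elim=> [a _|t h hh IH|a b h ab hh IH].
  - rewrite (eulerZ cl); suff -> : euler c 1 = 0 by rewrite scaler0.
    have := eulerM cl 1 1; rewrite !mulr1 mul1r => /eqP.
    by rewrite -[X in X == _]addr0 (inj_eq (addrI _)) => /eqP.
  - have [->|th0 dth] := eqVneq (pi 'X_t * h) 0; first by rewrite E0.
    have [dt dh] := delta_factor0 (homogeneous_mon _) (hprod_homogeneous hh)
      th0 dth.
    by rewrite (eulerM cl) (euler_var cl) cker // scale0r mul0r IH // mulr0
      addr0.
  have [->|th0 dth] := eqVneq (linear_form D a b * h) 0; first by rewrite E0.
  have hl : homogeneous (linear_form D a b).
    by eexists; apply: homogeneous_linear_form.
  have [dt dh] := delta_factor0 hl (hprod_homogeneous hh) th0 dth.
  rewrite (eulerM cl) (euler_linear_form cl) (lker _ _ ab dt).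
  by rewrite scale0r mul0r IH // mulr0 addr0.
move=> f df; have [r _ ->] := component_decomp f.
elim/big_rec: _ => // w h _ IH; rewrite (eulerD cl) IH addr0.
apply: hker; last exact: delta_component.
by apply/homogeneousP; exists w; apply: hom_component.
Qed.

Lemma natr_neq0 (e : nat) : (0 < e)%N -> e%:R != 0 :> K.
Proof. by rewrite (pcharf0P K).1 // -lt0n. Qed.

(* Otherwise l_j' T_j d/dT_j - l_j T_j' d/dT_j' would kill every x_k and hence
   the kernel of delta, and so be proportional to delta. *)
Lemma delta_var_uniq i (j j' : 'I_(n i)) :
  delta (T i j) != 0 -> delta (T i j') != 0 -> j = j'.
Proof.
move=> dj dj'; apply: contraTeq isT => jj'.
pose c s : K := if s == idx i j then (l i j')%:R
  else if s == idx i j' then - (l i j)%:R else 0.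
have cl k : \sum_(t < n k) c (idx k t) * (l k t)%:R = 0.
  rewrite /c; have [ki|ki] := eqVneq k i; last first.
    by rewrite big1 // => t _; rewrite !eq_tri_index (negPf ki) mul0r.
  subst k; rewrite (bigD1 j) //= (bigD1 j') 1?eq_sym //= !eq_tri_index !eqxx /=.
  rewrite eq_sym in jj'; rewrite !val_eqE (negPf jj') big1 ?addr0.
    by rewrite mulrC mulNr subrr.
  move=> t /andP[tj tj'].
  by rewrite !eq_tri_index !eqxx /= !val_eqE (negPf tj) (negPf tj') mul0r.
have cker s : delta (pi 'X_s) = 0 -> c s = 0.
  rewrite /c; case: eqP => [->|_]; first by move=> E; rewrite E eqxx in dj.
  by case: eqP => [->|_] // E; rewrite E eqxx in dj'.
have [s [hs ds E]] := euler_ker_prop cl cker (fun _ _ _ _ => erefl).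
have Es : euler c s = 0.
  (* As lambda = 0, the Euler derivation kills every x_k, while [delta] does not kill both x_0 and
     x_1. *)
  have Ei k : delta (pi (x k)) * euler c s = 0.
    by rewrite mulrC -E (euler_term cl) scale0r mulr0.
  have [d0|d0] := eqVneq (delta (pi (x 0))) 0; last first.
    by apply: reg (Ei 0) => //; apply/delta_homog/homogeneous_term.
  have [d1|d1] := eqVneq (delta (pi (x 1))) 0;
    first by case: (delta_terms_neq0 d0 d1).
  by apply: reg (Ei 1) => //; apply/delta_homog/homogeneous_term.
have /eqP := E (T i j); rewrite Es mul0r => /eqP/(reg (delta_homog hs) ds).
rewrite (euler_var cl) /c eqxx => /eqP; rewrite scaler_eq0 (negPf (var_neq0 j)).
by rewrite orbF (negPf (natr_neq0 _)) ?tri_l_gt0.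
Qed.

(** The first index is only a default for a block killed entirely by [delta]. *)
Definition active_index i : 'I_(n i) :=
  odflt (Ordinal (tri_n_gt0 D i)) [pick j | delta (T i j) != 0].

Lemma delta_inactive i j : j != active_index i -> delta (T i j) = 0.
Proof.
rewrite /active_index; case: pickP => [j' dj'|/(_ j)/eqP //] /= jj'.
by apply/eqP; apply: contraTT jj' => dj; rewrite negbK;
  apply/eqP/delta_var_uniq.
Qed.

Lemma delta_active i : delta (pi (x i)) != 0 ->
  delta (T i (active_index i)) != 0.
Proof.
apply: contra_neq => d0.
rewrite (delta_chain delta_inactive) big1 // => k _.
have [->|ki] := eqVneq k i; first by rewrite d0 mulr0.
by rewrite tri_termE mderivX tri_monE eq_sym (negPf ki) scale0r rmorph0 mul0r.
Qed.

(* Otherwise the Euler derivation that fixes every x_i would be proportional to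
   delta, which would then kill x_1 / x_0. *)
Lemma exists_linear_form_ker :
  exists a b, (a != 0) || (b != 0) /\ delta (linear_form D a b) = 0.
Proof.
apply: contrapT => no.
have lker a b : (a != 0) || (b != 0) -> delta (linear_form D a b) <> 0.
  by move=> ab d0; apply: no; exists a, b.
have dx i : delta (pi (x i)) != 0.
  have := term_neq0 i; have [a [b ->]] := @tri_proj_term_linear K D i => ne.
  apply/eqP/lker; apply: contra_neqT ne;
    rewrite negb_or !negbK => /andP[/eqP-> /eqP->].
  by rewrite /linear_form !scale0r addr0.
(* Only active variables get a weight, which makes the Euler derivation vanish on the variables of
   the kernel; the value 1/l gives each x_i weight 1. *)
pose c s : K := if tagnat.sig2 s == active_index (tagnat.sig1 s)
  then ((l _ (tagnat.sig2 s))%:R)^-1 else 0.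
have cE i j : c (idx i j) = if j == active_index i then ((l i j)%:R)^-1 else 0.
  exact: (tagnat_index (fun i j =>
    if j == active_index i then ((l i j)%:R)^-1 else 0)).
have cl i : \sum_(j < n i) c (idx i j) * (l i j)%:R = 1.
  rewrite (bigD1 (active_index i)) //= cE eqxx mulVf ?natr_neq0 ?tri_l_gt0 //.
  by rewrite big1 ?addr0 // => j /negPf ji; rewrite cE ji mul0r.
have cker s : delta (pi 'X_s) = 0 -> c s = 0.
  have [i [j ->]] := tri_indexP s; rewrite cE; case: eqP => // -> d0.
  by have := delta_active (dx i); rewrite d0 eqxx.
have [s [hs ds E]] :=
  euler_ker_prop cl cker (fun a b ab d0 => False_ind _ (lker a b ab d0)).
have /eqP := delta_not_fiber; apply.
apply/eqP; rewrite -subr_eq0; apply/eqP.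
apply: (reg (delta_homog hs) ds); rewrite mulrBr !mulrA.
have E' i : delta s * pi (x i) = euler c s * delta (pi (x i)).
  by rewrite -E (euler_term cl) scale1r.
by rewrite !E'; ring.
Qed.

Lemma delta_terms_shape : exists (beta : 'I_3 -> K) q,
  [/\ \sum_(i < 3) beta i = 0, exists i, beta i != 0, homogeneous q
    & forall i, delta (pi (x i)) = beta i *: q].
Proof.
have [a [b [ab dl]]] := exists_linear_form_ker.
set y0 := delta (pi (x 0)); set y1 := delta (pi (x 1)).
have y01 : a *: y0 + b *: y1 = 0 by move: dl; rewrite linearD !linearZ.
have dx2 : delta (pi (x 2%:R)) = - (y0 + y1).
  apply/eqP; rewrite -addr_eq0 addrC -addrA; apply/eqP.
  rewrite -(linear0 delta) -(tri_proj_trinomial K D) /trinomial.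
  rewrite !big_ord_recl big_ord0 addr0 !rmorphD !linearD /=.
  by congr (delta (pi (x _)) + (delta (pi (x _)) + delta (pi (x _))));
    apply: val_inj.
pose beta i : K := if i == 0 then b else if i == 1 then - a else a - b.
have [q [hq E0 E1]] : exists q, [/\ homogeneous q, y0 = b *: q & y1 = - a *: q].
  have hom_y i c : homogeneous (c *: delta (pi (x i))).
    exact/homogeneousZ/delta_homog/homogeneous_term.
  (* The relation makes (y0, y1) proportional to (b, -a); q is obtained by dividing by whichever of
     b and -a is nonzero. *)
  have [b0|b0] := eqVneq b 0.
    move: ab y01; rewrite b0 eqxx orbF scale0r addr0 => a0 /eqP.
    rewrite scaler_eq0 (negPf a0) /= => /eqP ->.
    exists ((- a)^-1 *: y1); split; [exact: hom_y|by rewrite scale0r|].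
    by rewrite scalerA divff ?oppr_eq0 // scale1r.
  exists (b^-1 *: y0); split; [exact: hom_y|by rewrite scalerA divff ?scale1r|].
  apply: (scalerI b0); apply/eqP;
    rewrite -subr_eq0 !scalerA mulrAC divff // mul1r.
  by rewrite scaleNr opprK addrC y01.
exists beta, q; split=> //.
- by rewrite /beta !big_ord_recl big_ord0 /=; ring.
- case/orP: ab => [a0|b0]; last by exists 0.
  by exists 1; rewrite /beta /= oppr_eq0.
case=> -[|[|[|//]]] Hi; rewrite /beta /=.
- by rewrite -E0; congr (delta (pi (x _))); apply: val_inj.
- by rewrite -E1; congr (delta (pi (x _))); apply: val_inj.
transitivity (delta (pi (x 2%:R))).
  by congr (delta (pi (x _))); apply: val_inj.
by rewrite dx2 E0 E1 -scalerDl -scaleNr opprD opprK addrC.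
Qed.

Lemma delta_elementary : elementary delta.
Proof.
have [beta [q [beta0 [i1 bi1] hq dx]]] := delta_terms_shape.
pose c := active_index; exists c, beta.
have q0 : q != 0.
  apply/eqP => q0; apply: delta_terms_neq0; by rewrite dx q0 scaler0.
have dterm_E k : pi (dterm K c k)
    = (l k (c k))%:R *: pi 'X_[tri_mon D k - U_(idx k (c k))].
  by rewrite /dterm tri_termE mderivX tri_monE eqxx linearZ.
have dm_supp k : block_supp k (tri_mon D k - U_(idx k (c k)))%MM.
  by move=> k' kk' j; rewrite mnmBE (block_supp_term kk').
have l0 k : (l k (c k))%:R != 0 :> K by rewrite natr_neq0 ?tri_l_gt0.
have hdterm k : homogeneous (pi (dterm K c k)).
  by rewrite dterm_E; apply/homogeneousZ/homogeneous_mon.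
have dterm0 k : pi (dterm K c k) != 0.
  by rewrite dterm_E scaler_eq0 (negPf (l0 k)) (negPf (mon_neq0 (dm_supp k))).
have dT i : beta i *: q = pi (dterm K c i) * delta (T i (c i)).
  rewrite -dx (delta_chain delta_inactive) (bigD1 i) //= big1 ?addr0 // => k ki.
  by rewrite tri_termE mderivX tri_monE eq_sym (negPf ki) scale0r rmorph0 mul0r.
have [h qE] : exists h, q = pi (\prod_(k < 3 | beta k != 0) dterm K c k) * h.
  have [||k|h qE] := @block_prod_dvd [seq k <- index_enum 'I_3 | beta k != 0]
    (fun k => tri_mon D k - U_(idx k (c k)))%MM q.
  - by rewrite filter_uniq // index_enum_uniq.
  - exact: dm_supp.
  - rewrite mem_filter => /andP[bk _].
    (* Solve [dT] for q: dividing by [beta k] leaves the monomial times this cofactor. *)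
    exists ((beta k)^-1 * (l k (c k))%:R *: delta (T k (c k))).
    apply: (scalerI bk); rewrite dT dterm_E -scalerAl -scalerAr scalerA mulrA.
    by rewrite divff // mul1r.
  (* The partial derivatives differ from the monomials by the exponents l, which are absorbed into
     h. *)
  exists ((\prod_(k < 3 | beta k != 0) (l k (c k))%:R)^-1 *: h).
  rewrite qE big_filter !rmorph_prod /=;
    under [in RHS]eq_bigr do rewrite dterm_E.
  rewrite scaler_prod -scalerAl -scalerAr scalerA divff ?scale1r //.
  by apply/prodf_neq0 => k _.
exists h.
have hh : homogeneous h.
  apply: (@homogeneous_div _ _ (pi (\prod_(k < 3 | beta k != 0) dterm K c k))).
  - rewrite rmorph_prod; elim/big_ind: _ => [||k _]; last exact: hdterm.
      by rewrite -(rmorph1 pi) -mpolyX0; apply: homogeneous_mon.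
    exact: homogeneousM.
  - by apply: contra_neq q0 => E; rewrite qE E mul0r.
  by rewrite -qE.
have h0 : h != 0 by apply: contra_neq q0 => E; rewrite qE E mulr0.
have dTE i : delta (T i (c i)) = h * pi (delta_value c beta i).
  have [bi|bi] := eqVneq (beta i) 0.
    by rewrite /delta_value bi scale0r rmorph0 mulr0 delta_var_term // dx bi
      scale0r.
  apply/eqP; rewrite -subr_eq0; apply/eqP; apply: (reg (hdterm i) (dterm0 i)).
  rewrite mulrBr -dT mulrCA -rmorphM /= /delta_value -scalerAr linearZ /=
    -scalerAr.
  rewrite qE (bigD1 i) //= mulrC; under eq_bigl do rewrite andbC.
  by rewrite subrr.
have dE f : delta f = h * delta_CB c beta f.
  have [p ->] := tri_proj_surj f.
  rewrite (delta_chain delta_inactive) delta_CB_proj // rmorph_sum mulr_sumr.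
  by apply: eq_bigr => i _; rewrite dTE rmorphM /= mulrCA [pi p^`M(_) * _]mulrC.
split=> //; last first.
  (* Here h divides [delta h], so [delta h = 0], and the regular factor h can be cancelled. *)
  by apply: (reg hh h0); rewrite -dE; apply: self (dE h).
(* Two zero entries force the third to vanish, as the sum is zero, but [beta] is nonzero. *)
have beta2 i k : i != k -> beta i = 0 -> beta k = 0 -> False.
  move=> ik bi bk; have [r [ri rk]] := third_index i k.
  have cover t : t != r -> beta t = 0.
    move=> tr; suff /orP[/eqP->|/eqP->] : (t == i) || (t == k) by [].
    case: i k r t {bi bk} ik ri rk tr => -[|[|[|//]]] ? [[|[|[|//]]] ?]
      [[|[|[|//]]] ?] [[|[|[|//]]] ?] //.
  have br : beta r = 0 by move: beta0; rewrite (bigD1 r) //= big1 ?addr0.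
  by move: bi1; have [->|/cover ->] := eqVneq i1 r; rewrite ?br eqxx.
(* An exponent above 1 leaves a factor of the active variable in its [dterm], hence in the
   derivatives of the other active variables. Two such blocks would give active variables dividing
   each other's derivatives, so one derivative would vanish. *)
have two i k : beta i != 0 -> beta k != 0 ->
    (1 < l i (c i))%N -> (1 < l k (c k))%N -> i = k.
  move=> bi bk li lk; apply: contraTeq isT => ik.
  have dvd r t : r != t -> beta r != 0 -> (1 < l r (c r))%N ->
      exists u, delta (T t (c t)) = T r (c r) * u.
    move=> rt br lr; have [e eE] : exists e, pi (dterm K c r) = T r (c r) * e.
      exists ((l r (c r))%:R
        *: pi 'X_[tri_mon D r - U_(idx r (c r)) - U_(idx r (c r))]).
      rewrite dterm_E -scalerAr -rmorphM -mpolyXD addmC submK // lep1mP mnmBE.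
      by rewrite tri_monE eqxx mnm1E eqxx -lt0n subn_gt0.
    rewrite dTE /delta_value (bigD1 r) ?rt ?br // linearZ rmorphM /= eE.
    by rewrite -mulrA scalerAr mulrCA; eexists.
  have act t : beta t != 0 -> delta (T t (c t)) <> 0.
    move=> bt; apply/eqP/delta_active; rewrite dx.
    by rewrite scaler_eq0 (negPf bt) (negPf q0).
  have [u du] := dvd _ _ ik bi li; rewrite eq_sym in ik.
  have [v dv] := dvd _ _ ik bk lk.
  by case: (cross (homogeneous_mon _) (homogeneous_mon _) du dv) => /act.
split=> //; first by exists i1.
have [[i0 /eqP b0]|no] := pselect (exists i, beta i == 0).
  right; exists i0; split=> // [i ii0|i k ii0 ki0].
    by apply/eqP => bi; apply: (beta2 _ _ ii0).
  by apply: two; apply/eqP => bt; apply: (beta2 _ i0 _ bt).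
have nz i : beta i != 0 by apply/negP => bi; apply: no; exists i.
by left; split=> // i k; apply: two.
Qed.

End Nonzero.

End HomogeneousLND.

Theorem theorem1 (K : closedFieldType) (charK0 : [pchar K] =i pred0)
    (D : trinomial_data)
    (delta : {linear trinomial_algebra K D -> trinomial_algebra K D})
    (delta_der : is_derivation delta)
    (delta_lnd : locally_nilpotent delta)
    (delta_homog : finely_homogeneous delta)
    (* The zero derivation is of the form h * delta_CB only if some delta_CB
       exists; otherwise delta has to be nonzero. *)
    (delta_neq0 : (exists f : trinomial_algebra K D, delta f != 0) \/
       (exists (c : forall i, 'I_(tri_n D i)) (beta : 'I_3 -> K),
          admissible c beta)) :
  elementary delta.
Proof.
have [[f df]|no] := pselect (exists f, delta f != 0).
  exact: delta_elementary df.
have d0 f : delta f = 0 by apply/eqP; apply: contraPT no => df; apply; exists f.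
case: delta_neq0 => [//|[c [beta adm]]]; exists c, beta, 0; split=> //.
- by exists 0; apply/homogeneous_componentP; rewrite linear0.
- have [_ beta0 _] := adm; rewrite -(rmorph0 (@tri_proj K D)) delta_CB_proj //.
  by have := delta_polyZ c beta 0 0; rewrite !scale0r => ->.
by move=> f; rewrite d0 mul0r.
Qed.
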